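(* Let $\{r_i\}_{i=1}^\infty$ be the sequence of all rational numbers in lowest terms in the open interval $(0,1)$, ordered first by increasing denominator and, for equal denominators, by increasing numerator: \[ r_1=\tfrac12,\ r_2=\tfrac13,\ r_3=\tfrac23,\ r_4=\tfrac14,\ r_5=\tfrac34,\ \dots \] For a rational $r\in(0,1)$ let $L(r)$ denote the number of digits in its (finite) continued fraction expansion. Let $f:\mathbb{N}\to\mathbb{N}$ and let $x_f$ be the real number whose continued fraction expansion is obtained by concatenating, in order, the finite continued fraction expansions of $r_{f(1)}, r_{f(2)}, r_{f(3)},\dots$. Suppose that \[ N= o\Big( \sum_{n=1}^N L(r_{f(n)}) \Big) \quad\text{and}\quad N\cdot \max_{1\le n \le N} L(r_{f(n)}) = O\Big( \sum_{n=1}^N L(r_{f(n)})\Big) \] as $N\to\infty$, and that for every set $S\subset\mathbb{N}$ with $\#\{n\in S: n\le x\}=O(x/\log x)$, the set $f^{-1}(S)$ has asymptotic density $0$. Then $x_f$ is CF-normal.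
   Context: Every $x\in[0,1)$ has a continued fraction expansion $x=\langle a_1,a_2,\dots\rangle=1/(a_1+1/(a_2+\cdots))$ with $a_i\in\mathbb{N}$; it is infinite and unique for irrational $x$. A rational number has two finite expansions (one ending in a digit $\ge 2$, one ending in $1$); by convention the longer one (ending in the digit $1$) is always used. The Gauss measure is $\mu(A)=\frac{1}{\log 2}\int_A \frac{dx}{1+x}$. For a finite string $s=[d_1,\dots,d_k]$ of positive integers, the cylinder set is $C_s=\{x\in[0,1): a_i(x)=d_i,\ 1\le i\le k\}$. For real $x$, $A_s(N;x)$ is the number of indices $1\le i\le N$ such that the string $s$ occurs in the continued fraction expansion of $x$ starting at digit $a_i$. A number $x\in[0,1)$ is CF-normal if $\lim_{N\to\infty}A_s(N;x)/N=\mu(C_s)$ for every finite string $s$ of positive integers. A set $S\subset\mathbb{N}$ has asymptotic density $\rho$ if $\#\{n\le N:n\in S\}/N\to\rho$. *)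

(* Defs.v *)
From HB Require Import structures.
From mathcomp Require Import all_boot all_order all_algebra.
From mathcomp Require Import all_classical all_reals all_analysis.
Set Implicit Arguments. Unset Strict Implicit. Unset Printing Implicit Defensive.
Import Order.TTheory GRing.Theory Num.Theory.
Import numFieldNormedType.Exports.
Local Open Scope classical_set_scope.
Local Open Scope ring_scope.

Fixpoint cf_greedy (fuel p q : nat) : seq nat :=
  match fuel with
  | 0 => [::]
  | fuel'.+1 => if p == 0%N then [::] else (q %/ p)%N :: cf_greedy fuel' (q %% p) p
  end.

(* The finite CF expansion of p/q in (0,1) with the paper's convention:
   the longer expansion, ending in the digit 1 ( ..., a_k with a_k >= 2
   becomes ..., a_k - 1, 1 ). *)
Definition cf_rat (r : nat * nat) : seq nat :=
  let s := cf_greedy r.2.+1 r.1 r.2 in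
  if s is a :: s' then
    let l := last a s' in
    if (1 < l)%N then rcons (rcons (belast a s') l.-1) 1 else s
  else s.

Definition Lcf (r : nat * nat) : nat := size (cf_rat r).

Definition rat_list (Q : nat) : seq (nat * nat) :=
  flatten [seq [seq (p, q) | p <- iota 1 q.-1 & coprime p q] | q <- iota 2 Q].

(* r_i (i >= 1): the i-th reduced fraction in (0,1) in the above order
   (r_1 = 1/2, r_2 = 1/3, r_3 = 2/3, r_4 = 1/4, ...). The list rat_list i
   has at least i elements, and these lists are prefixes of each other. *)
Definition rseq (i : nat) : nat * nat := nth (0%N, 1%N) (rat_list i) i.-1.

Definition xf_prefix (f : nat -> nat) (N : nat) : seq nat :=
  flatten [seq cf_rat (rseq (f n)) | n <- iota 1 N].

Definition xf_digit (f : nat -> nat) (i : nat) : nat := nth 0%N (xf_prefix f i) i.-1.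

Definition SL (f : nat -> nat) (N : nat) : nat := (\sum_(1 <= n < N.+1) Lcf (rseq (f n)))%N.
Definition ML (f : nat -> nat) (N : nat) : nat := (\max_(1 <= n < N.+1) Lcf (rseq (f n)))%N.

Definition count_upto (S : pred nat) (N : nat) : nat := count S (iota 1 N).

Definition density_zero {R : realType} (S : pred nat) : Prop :=
  (fun N : nat => (count_upto S N)%:R / (N%:R : R)) @ \oo --> (0 : R).

Definition gauss_map {R : realType} (x : R) : R :=
  if x == 0 then 0 else x^-1 - (Num.floor (x^-1))%:~R.

Definition cf_digit {R : realType} (x : R) (i : nat) : nat :=
  Num.truncn ((iter i.-1 gauss_map x)^-1).

Definition gauss_measure {R : realType} (A : set R) : \bar R :=
  (\int[@lebesgue_measure R]_(y in A) ((1 + y)^-1 / ln 2)%:E)%E.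

Definition cylinder {R : realType} (s : seq nat) : set R :=
  [set x | 0 <= x < 1 /\ forall j, (j < size s)%N -> cf_digit x j.+1 = nth 0%N s j].

Definition occ_count {R : realType} (s : seq nat) (N : nat) (x : R) : nat :=
  count (fun i => all (fun j => cf_digit x (i + j) == nth 0%N s j) (iota 0 (size s)))
        (iota 1 N).

Definition CF_normal {R : realType} (x : R) : Prop :=
  forall s : seq nat, (0 < size s)%N -> all (fun d => 0 < d)%N s ->
    (fun N : nat => ((occ_count s N x)%:R / (N%:R : R))%:E) @ \oo
      --> gauss_measure (@cylinder R s).

(* Main.v *)
(* The map from a rational of denominator q to its digit word w turns the count of
   exceptional fractions into a measure estimate: the cylinder of w has length at
   least 1/(2 q^2), and the squares of the continuants at most m of the prefixes of
   a given digit sequence sum to at most 2 m^2.  So the number of words with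
   continuant at most m and at least c log m digits in which s has the wrong
   frequency is at most 4 m^2 times the probability that a random digit sequence
   has such a prefix; shorter words are rare by Rankin's trick with exponent 3/2.
   Under Lebesgue measure the ratio t of the last two convergent denominators is a
   Markov chain t -> 1/(d+t).  Its transfer operator reverses monotonicity, hence
   contracts Lipschitz constants by the factor by which it contracts the identity;
   the resulting exponential mixing bounds the variance of the number of
   occurrences of s in k digits by O(k), and Chebyshev's inequality on a grid of
   boundedly many lengths gives probability O(1/log m).  Thus the exceptional indices
   have counting function O(x/log x), their preimage under f has density zero, and
   the two growth hypotheses make the contribution of exceptional blocks and of
   block boundaries negligible. *)
Require Import Defs.
From HB Require Import structures.
From mathcomp Require Import all_boot all_order all_algebra.
From mathcomp Require Import all_classical all_reals all_analysis.
From mathcomp Require Import measurable_realfun.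
From mathcomp Require Import zify ring lra.
Set Implicit Arguments. Unset Strict Implicit. Unset Printing Implicit Defensive.
Import Order.TTheory GRing.Theory Num.Theory.
Import numFieldNormedType.Exports.
Local Open Scope classical_set_scope.
Local Open Scope ring_scope.

(** * The digit chain and the contraction of its transfer operator *)

Definition poss (w : seq nat) : bool := all (fun d => 0 < d)%N w.

Section Chain.
Context {R : realFieldType}.
Implicit Types (t x : R) (p : nat -> R -> R) (d D k : nat).

(* If [t] is the ratio of the last two convergent denominators, [tailp d t] is the
   Lebesgue probability that the next digit is at least [d], and [next d t] is the
   new ratio once the digit [d] has been read. [capp D] moves the mass of all
   digits above [D] to [D], which keeps every sum finite. *)
Definition tailp d t : R := (1 + t) / (d%:R + t).
Definition digp d t : R := tailp d t - tailp d.+1 t.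
Definition capp D d t : R := if (d < D)%N then digp d t else tailp d t.
Definition next d t : R := (d%:R + t)^-1.

Definition in01 t : Prop := 0 <= t <= 1.

Fixpoint words D k : seq (seq nat) :=
  if k is k'.+1 then [seq d :: w | d <- iota 1 D, w <- words D k'] else [:: [::]].

(** The probability of reading the word [u] from state [t] under the digit law [p]. For [p = digp]
    and [t = 0] it is the Lebesgue length of the cylinder of [u]. *)
Fixpoint wt p t (u : seq nat) : R :=
  if u is d :: u' then p d t * wt p (next d t) u' else 1.

Fixpoint walk t (u : seq nat) : R := if u is d :: u' then walk (next d t) u' else t.

(** For [p = capp D] with [D > 0] this is an expectation over [k] random digits; for [p = digp] the
    words with a digit above [D] are missing, so the total mass is below 1 when [k > 0]. *)
Definition Ex p D k t (F : seq nat -> R) : R := \sum_(u <- words D k) wt p t u * F u.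

Definition transfer D (F : R -> R) t : R := \sum_(d <- iota 1 D) capp D d t * F (next d t).

Lemma big_iotaS n (x : nat -> R) :
  \sum_(d <- iota 1 n.+1) x d = \sum_(d <- iota 1 n) x d + x n.+1.
Proof. by rewrite -{1}(addn1 n) iotaD big_cat big_seq1. Qed.

Lemma ler1n_digit d : (0 < d)%N -> 1 <= d%:R :> R.
Proof. by rewrite ler1n. Qed.

Lemma next01 d t : (0 < d)%N -> in01 t -> in01 (next d t).
Proof.
move=> /ler1n_digit d1 /andP[t0 t1]; rewrite /in01 /next invr_ge0 invf_le1; lra.
Qed.

Lemma walk01 t u : poss u -> in01 t -> in01 (walk t u).
Proof.
elim: u t => //= d u IH t /andP[d0 u0] t01; exact/IH/next01.
Qed.

Lemma digpE d t : (0 < d)%N -> 0 <= t ->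
  digp d t = (1 + t) / ((d%:R + t) * (d%:R + t + 1)).
Proof.
move=> /ler1n_digit d1 t0; rewrite /digp /tailp -natr1; field.
by apply/andP; split; lra.
Qed.

Lemma tailp_ge0 d t : 0 <= t -> 0 <= tailp d t.
Proof. by move=> t0; rewrite divr_ge0 ?addr_ge0. Qed.

Lemma digp_ge0 d t : (0 < d)%N -> 0 <= t -> 0 <= digp d t.
Proof.
move=> d0 t0; rewrite digpE // divr_ge0 ?addr_ge0 // mulr_ge0 ?addr_ge0 //.
Qed.

Lemma capp_ge0 D d t : (0 < d)%N -> 0 <= t -> 0 <= capp D d t.
Proof. by move=> d0 t0; rewrite /capp; case: ifP; rewrite ?digp_ge0 ?tailp_ge0. Qed.

Lemma digp_le_capp D d t : (0 < d)%N -> 0 <= t -> digp d t <= capp D d t.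
Proof.
move=> d0 t0; rewrite /capp; case: ifP => // _.
by rewrite /digp lerBlDr lerDl tailp_ge0.
Qed.

Lemma in_words D k u :
  (u \in words D k) = (size u == k) && all (fun d => 0 < d <= D)%N u.
Proof.
elim: k u => [|k IH] [|d u] //=; first by apply/allpairsP => -[[? ?]] /= [_ _].
apply/allpairsP/idP => [[[e w]] /= [e1 e2 [-> ->]]|/andP[s1 /andP[d1 d2]]].
  by move: e1 e2; rewrite mem_iota IH eqSS => ? /andP[-> ->]; lia.
by exists (d, u); rewrite /= mem_iota IH -eqSS s1 d2; split=> //; lia.
Qed.

Lemma words_uniq D k : uniq (words D k).
Proof.
elim: k => //= k IH; apply: allpairs_uniq => //; first exact: iota_uniq.
by move=> [a b] [c d] _ _ /= [-> ->].
Qed.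

Lemma words_pos D k u : u \in words D k -> poss u.
Proof.
by rewrite in_words => /andP[_]; apply: sub_all => d /andP[].
Qed.

Lemma wt_ge0 p t u : (forall d t, (0 < d)%N -> 0 <= t -> 0 <= p d t) ->
  poss u -> 0 <= t -> 0 <= wt p t u.
Proof.
move=> hp; elim: u t => [|d u IH] t //= /andP[d0 u0] t0.
by rewrite mulr_ge0 ?hp ?IH // invr_ge0 addr_ge0.
Qed.

Lemma wt_cat p t u v : wt p t (u ++ v) = wt p t u * wt p (walk t u) v.
Proof. by elim: u t => [|d u IH] t /=; rewrite ?mul1r // IH mulrA. Qed.

Lemma wt_digp_le_capp D t u : poss u -> 0 <= t ->
  wt digp t u <= wt (capp D) t u.
Proof.
elim: u t => [|d u IH] t //= /andP[d0 u0] t0.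
have n0 : 0 <= next d t by rewrite invr_ge0 addr_ge0.
by rewrite ler_pM ?digp_ge0 ?digp_le_capp ?IH // wt_ge0 // => *; apply: digp_ge0.
Qed.

Lemma ExS p D k t F :
  Ex p D k.+1 t F = \sum_(d <- iota 1 D) p d t * Ex p D k (next d t) (fun w => F (d :: w)).
Proof.
rewrite /Ex /= big_allpairs_dep; apply: eq_bigr => d _; rewrite big_distrr /=.
by apply: eq_bigr => w _; rewrite mulrA.
Qed.

Lemma Ex0 p D t F : Ex p D 0 t F = F [::].
Proof. by rewrite /Ex big_seq1 mul1r. Qed.

Lemma eq_Ex p D k t F G : (forall u, u \in words D k -> F u = G u) ->
  Ex p D k t F = Ex p D k t G.
Proof. by move=> FG; rewrite /Ex; apply: eq_big_seq => u /FG ->. Qed.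

Lemma ExD p D k t F G : Ex p D k t (fun u => F u + G u) = Ex p D k t F + Ex p D k t G.
Proof. by rewrite /Ex -big_split; apply: eq_bigr => u _ /=; rewrite mulrDr. Qed.

Lemma ExZ p D k t a F : Ex p D k t (fun u => a * F u) = a * Ex p D k t F.
Proof. by rewrite /Ex big_distrr; apply: eq_bigr => u _ /=; rewrite mulrCA. Qed.

Lemma Ex_sum p D k t (I : Type) (r : seq I) (P : pred I) (F : I -> seq nat -> R) :
  Ex p D k t (fun u => \sum_(i <- r | P i) F i u) = \sum_(i <- r | P i) Ex p D k t (F i).
Proof.
rewrite /Ex exchange_big /=; apply: eq_bigr => u _; by rewrite big_distrr.
Qed.

Lemma Ex_cat p D j k t F :
  Ex p D (j + k) t F = Ex p D j t (fun v => Ex p D k (walk t v) (fun w => F (v ++ w))).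
Proof.
elim: j t F => [|j IH] t F; first by rewrite Ex0.
by rewrite addSn !ExS; apply: eq_bigr => d _; rewrite IH.
Qed.

Lemma le_Ex D k t F G : 0 <= t -> (forall u, u \in words D k -> F u <= G u) ->
  Ex (capp D) D k t F <= Ex (capp D) D k t G.
Proof.
move=> t0 FG; rewrite /Ex big_seq [leRHS]big_seq ler_sum // => u hu.
rewrite ler_wpM2l ?FG // wt_ge0 // ?(words_pos hu) // => *; exact: capp_ge0.
Qed.

(* Abel summation: the capped digit distribution has tails P(a >= j) = tailp j t
   for j <= D. *)
Lemma capped_sum_Abel D t (x : nat -> R) :
  \sum_(d <- iota 1 D.+1) capp D.+1 d t * x d =
  tailp 1 t * x 1%N + \sum_(d <- iota 1 D) tailp d.+1 t * (x d.+1 - x d).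
Proof.
have E n : \sum_(d <- iota 1 n) digp d t * x d + tailp n.+1 t * x n.+1 =
    tailp 1 t * x 1%N + \sum_(d <- iota 1 n) tailp d.+1 t * (x d.+1 - x d).
  elim: n => [|n IH]; first by rewrite !big_nil; ring.
  rewrite !big_iotaS addrA -IH /digp; ring.
rewrite -E big_iotaS /capp ltnn; congr (_ + _).
by apply: eq_big_seq => d; rewrite mem_iota => /andP[_ dn]; rewrite ifT //; lia.
Qed.

Lemma tailp1 t : 0 <= t -> tailp 1 t = 1.
Proof. by move=> t0; rewrite /tailp divff //; lra. Qed.

Lemma capp_sum1 D t : 0 <= t -> \sum_(d <- iota 1 D.+1) capp D.+1 d t = 1.
Proof.
move=> t0; have := capped_sum_Abel D t (fun=> 1).
under eq_bigr do rewrite mulr1; move=> ->; rewrite tailp1 //.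
by rewrite big1 ?addr0 ?mulr1 // => *; rewrite subrr mulr0.
Qed.

Lemma Ex1 D k t : 0 <= t -> Ex (capp D.+1) D.+1 k t (fun=> 1) = 1.
Proof.
elim: k t => [|k IH] t t0; first by rewrite Ex0.
rewrite ExS -[RHS](capp_sum1 D t0); apply: eq_bigr => d _.
by rewrite IH ?mulr1 // invr_ge0 addr_ge0.
Qed.

Lemma Ex_const D k t c : 0 <= t -> Ex (capp D.+1) D.+1 k t (fun=> c) = c.
Proof.
move=> t0; rewrite -[RHS]mulr1 -(Ex1 D k t0) -ExZ.
by apply: eq_Ex => u _; rewrite mulr1.
Qed.

Lemma walk_ge0 t u : 0 <= t -> 0 <= walk t u.
Proof. by elim: u t => //= d u IH t t0; rewrite IH // invr_ge0 addr_ge0. Qed.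

(** The capped law has total mass 1, so the digits after the [j]-th integrate out. *)
Lemma Ex_take D j k t F : (j <= k)%N -> 0 <= t ->
  Ex (capp D.+1) D.+1 k t (fun u => F (take j u)) = Ex (capp D.+1) D.+1 j t F.
Proof.
move=> /subnKC <- t0; rewrite Ex_cat; apply: eq_Ex => v; rewrite in_words => /andP[/eqP <- hv].
rewrite (@eq_Ex _ _ _ _ _ (fun=> F v)) ?Ex_const ?walk_ge0 // => w _.
by rewrite take_size_cat.
Qed.

Lemma Ex_prefix D k t w : w \in words D.+1 (size w) -> (size w <= k)%N -> 0 <= t ->
  Ex (capp D.+1) D.+1 k t (fun u => (prefix w u)%:R) = wt (capp D.+1) t w.
Proof.
move=> hw wk t0.
transitivity (Ex (capp D.+1) D.+1 k t (fun u => (w == take (size w) u)%:R)).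
  by apply: eq_Ex => u _; rewrite prefixE eq_sym.
rewrite (@Ex_take D (size w) k t (fun v => (w == v)%:R)) // /Ex.
rewrite (bigD1_seq w) ?words_uniq //= eqxx mulr1 big1 ?addr0 // => v.
by rewrite eq_sym => /negbTE ->; rewrite mulr0.
Qed.

Lemma le_norm_Ex D k t F c : 0 <= t -> (forall u, u \in words D.+1 k -> `|F u| <= c) ->
  `|Ex (capp D.+1) D.+1 k t F| <= c.
Proof.
move=> t0 Fc; rewrite ler_norml; apply/andP; split.
  by rewrite -(Ex_const D k (-c) t0) le_Ex // => u /Fc; rewrite ler_norml => /andP[].
by rewrite -[leRHS](Ex_const D k c t0) le_Ex // => u /Fc; rewrite ler_norml => /andP[].
Qed.

Lemma transfer_iter D n t F :
  iter n (transfer D) F t = Ex (capp D) D n t (fun u => F (walk t u)).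
Proof.
elim: n t => [|n IH] t; first by rewrite Ex0.
by rewrite iterS /transfer ExS; apply: eq_bigr => d _; rewrite IH.
Qed.

(** * Lipschitz contraction of the transfer operator *)

Definition lipschitz01 (L : R) (F : R -> R) : Prop :=
  forall t t', 0 <= t -> t <= t' -> t' <= 1 -> `|F t - F t'| <= L * (t' - t).

Lemma tailp_mono d t t' : (0 < d)%N -> 0 <= t -> t <= t' -> tailp d t <= tailp d t'.
Proof.
move=> /ler1n_digit d1 t0 tt; rewrite /tailp ler_pdivrMr; last lra.
rewrite mulrAC ler_pdivlMr; last lra.
nra.
Qed.

Lemma next_anti d t t' : (0 < d)%N -> 0 <= t -> t <= t' -> next d t' <= next d t.
Proof. by move=> /ler1n_digit d1 t0 tt; rewrite /next lef_pV2 ?posrE; lra. Qed.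

Lemma next_antiS d t : (0 < d)%N -> 0 <= t -> next d.+1 t <= next d t.
Proof.
move=> /ler1n_digit d1 t0; rewrite /next lef_pV2 ?posrE -?natr1; lra.
Qed.

(* Stochastic monotonicity: a larger state makes large digits likelier, and
   both effects decrease the next state. *)
Lemma transfer_anti D F t t' :
  (forall a b, 0 <= a -> a <= b -> b <= 1 -> F a <= F b) ->
  0 <= t -> t <= t' -> t' <= 1 -> transfer D.+1 F t' <= transfer D.+1 F t.
Proof.
move=> Fm t0 tt t1.
have F01 d s : (0 < d)%N -> 0 <= s -> s <= 1 -> 0 <= next d s /\ next d s <= 1.
  by move=> d0 s0 s1; apply/andP; apply: next01 => //; apply/andP.
apply: (@le_trans _ _ (\sum_(d <- iota 1 D.+1) capp D.+1 d t' * F (next d t))).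
  rewrite /transfer big_seq [leRHS]big_seq ler_sum // => d; rewrite mem_iota => /andP[d0 _].
  rewrite ler_wpM2l ?capp_ge0 //; first lra.
  have [? ?] := F01 d t d0 t0 (le_trans tt t1).
  have [? ?] := F01 d t' d0 (le_trans t0 tt) t1.
  by apply: Fm => //; apply: next_anti.
rewrite /transfer (capped_sum_Abel D t' (fun d => F (next d t))).
rewrite (capped_sum_Abel D t (fun d => F (next d t))).
rewrite !tailp1; try lra.
rewrite lerD2l big_seq [leRHS]big_seq ler_sum // => d; rewrite mem_iota => /andP[d0 _].
rewrite ler_wnM2r ?tailp_mono // subr_le0.
have [? ?] := F01 d.+1 t isT t0 (le_trans tt t1).
have [? ?] := F01 d t d0 t0 (le_trans tt t1).
by apply: Fm => //; apply: next_antiS.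
Qed.

(** Partial fractions give [digp d t * next d t = (1+t)/(d+t)^2 - digp d t], and the [digp] terms
    telescope. The remaining terms can be examined one by one as functions of [t]. *)
Lemma transfer_id D t : 0 <= t ->
  transfer D.+1 id t =
  \sum_(d <- iota 1 D.+1) (1 + t) / (d%:R + t) ^+ 2 - 1 + (1 + t) / (D.+1%:R + t).
Proof.
move=> t0.
rewrite /transfer.
have -> : \sum_(d <- iota 1 D.+1) capp D.+1 d t * next d t =
   \sum_(d <- iota 1 D) ((1 + t) / (d%:R + t) ^+ 2 - digp d t)
   + (1 + t) / (D.+1%:R + t) ^+ 2.
  rewrite big_iotaS /capp ltnn.
  congr (_ + _); last by rewrite /tailp /next expr2 invfM mulrA.
  apply: eq_big_seq => d; rewrite mem_iota => /andP[d0 dD].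
  rewrite ifT; last by lia.
  have d1 := ler1n_digit d0.
  by rewrite digpE // /next; field; apply/andP; split; lra.
rewrite big_split big_iotaS /=.
have -> : \sum_(d <- iota 1 D) - digp d t = tailp D.+1 t - 1.
  elim: D => [|n IH]; first by rewrite big_nil tailp1 // subrr.
  rewrite big_iotaS IH /digp; ring.
rewrite /tailp; ring.
Qed.

(** The difference carries the factor [d^2 - 2d - (t + t' + t t')], nonnegative for [d >= 3] because
    the bracket is at most 3. So only the digits 1 and 2 can make [transfer id] decrease. *)
Lemma summand_mono d t t' : (2 < d)%N -> 0 <= t -> t <= t' -> t' <= 1 ->
  (1 + t) / (d%:R + t) ^+ 2 <= (1 + t') / (d%:R + t') ^+ 2.
Proof.
move=> d2 t0 tt t1; have d3 : 3%:R <= d%:R :> R by rewrite ler_nat.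
rewrite ler_pdivrMr; last by rewrite exprn_gt0 //; lra.
rewrite mulrAC ler_pdivlMr; last by rewrite exprn_gt0 //; lra.
rewrite -subr_ge0.
have -> : (1 + t') * (d%:R + t) ^+ 2 - (1 + t) * (d%:R + t') ^+ 2 =
  (t' - t) * (d%:R ^+ 2 - 2 * d%:R - t - t' - t * t') by ring.
rewrite mulr_ge0; [by []| lra|nra].
Qed.

Definition theta : R := 253%:R / 256%:R.

(* With v = t + t' + t t', the three terms d = 1, 2, 3 contribute at most
   1/(1+v) + v/16 - (3-v)/256 <= theta for 0 <= v <= 3. *)
Lemma transfer_id_lip D t t' : 0 <= t -> t <= t' -> t' <= 1 ->
  transfer D.+3 id t - transfer D.+3 id t' <= theta * (t' - t).
Proof.
move=> t0 tt t1; rewrite !transfer_id ?(le_trans t0) //.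
pose phi d s : R := (1 + s) / (d%:R + s) ^+ 2.
have -> : iota 1 D.+3 = [:: 1; 2; 3]%N ++ iota 4 D by [].
rewrite !big_cat /= !big_cons !big_nil !addr0.
have H : \sum_(d <- iota 4 D) phi d t <= \sum_(d <- iota 4 D) phi d t'.
  rewrite big_seq [leRHS]big_seq ler_sum // => d; rewrite mem_iota => /andP[d4 _].
  by apply: summand_mono => //; lia.
have T : (1 + t) / (D.+3%:R + t) <= (1 + t') / (D.+3%:R + t').
  exact: (@tailp_mono D.+3).
rewrite -/(phi 1%N t) -/(phi 2%N t) -/(phi 3%N t) -/(phi 1%N t') -/(phi 2%N t') -/(phi 3%N t').
have e1 : phi 1%N t - phi 1%N t' = (t' - t) * ((1 + t) * (1 + t'))^-1.
  by rewrite /phi; field; apply/andP; split; lra.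
pose v := t + t' + t * t'.
have v0 : 0 <= v by rewrite /v; nra.
have v3 : v <= 3 by rewrite /v; nra.
have e2 : phi 2%N t - phi 2%N t' <= (t' - t) * (v / 16).
  have -> : phi 2%N t - phi 2%N t' = (t' - t) * (v / ((2 + t) ^+ 2 * (2 + t') ^+ 2)).
    by rewrite /phi /v; field; apply/andP; split; lra.
  rewrite ler_wpM2l ?subr_ge0 // ler_wpM2l // lef_pV2 ?posrE ?mulr_gt0 ?exprn_gt0 //; try lra.
  have : 4 <= (2 + t) ^+ 2 by rewrite expr2; nra.
  have : 4 <= (2 + t') ^+ 2 by rewrite expr2; nra.
  nra.
have e3 : phi 3%N t - phi 3%N t' <= - ((t' - t) * ((3 - v) / 256)).
  have -> : phi 3%N t - phi 3%N t' = - ((t' - t) * ((3 - v) / ((3 + t) ^+ 2 * (3 + t') ^+ 2))).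
    by rewrite /phi /v; field; apply/andP; split; lra.
  rewrite lerN2 ler_wpM2l ?subr_ge0 // ler_wpM2l ?subr_ge0 //.
  rewrite lef_pV2 ?posrE ?mulr_gt0 ?exprn_gt0 //; try lra.
  have : (3 + t) ^+ 2 <= 16 by rewrite expr2; nra.
  have : (3 + t') ^+ 2 <= 16 by rewrite expr2; nra.
  have : 0 <= (3 + t) ^+ 2 by rewrite expr2; nra.
  have : 0 <= (3 + t') ^+ 2 by rewrite expr2; nra.
  nra.
have key : (1 + v)^-1 + v / 16 - (3 - v) / 256 <= theta.
  (* The slope 17/256 = 1/16 + 1/256 cancels the linear terms in [v] and leaves 1 - 3/256 =
     [theta]. *)
  rewrite /theta; have : (1 + v)^-1 <= 1 - 17 / 256 * v.
    rewrite -[leLHS]mul1r ler_pdivrMr; last lra.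
    nra.
  lra.
have ev : (1 + t) * (1 + t') = 1 + v by rewrite /v; ring.
have := ler_wpM2l _ key => /(_ (t' - t)); rewrite subr_ge0 => /(_ tt).
rewrite ev in e1; lra.
Qed.

Lemma transfer_lin D a b F G t :
  transfer D (fun s => a * F s + b * G s) t = a * transfer D F t + b * transfer D G t.
Proof.
rewrite /transfer !big_distrr -big_split; apply: eq_bigr => d _ /=; ring.
Qed.

(** Both [L id + F] and [L id - F] are increasing, so their images under the operator are
    decreasing. Hence the image of [F] varies by at most [L] times the variation of the image of
    [id]. *)
Lemma transfer_contract D L F : 0 <= L -> lipschitz01 L F ->
  lipschitz01 (theta * L) (transfer D.+3 F).
Proof.
move=> L0 LF t t' t0 tt t1.
have m a : (forall s s', 0 <= s -> s <= s' -> s' <= 1 ->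
    L * s + a * F s <= L * s' + a * F s') ->
    a * (transfer D.+3 F t' - transfer D.+3 F t) <= theta * L * (t' - t).
  move=> mono; have := transfer_anti D.+2 mono t0 tt t1.
  have E s : transfer D.+3 (fun s => L * s + a * F s) s = L * transfer D.+3 id s + a * transfer D.+3 F s.
    exact: transfer_lin.
  rewrite !E; have := ler_wpM2l L0 (transfer_id_lip D t0 tt t1); lra.
have H1 := m 1; have H2 := m (-1).
rewrite ler_norml; apply/andP; split.
  suff : 1 * (transfer D.+3 F t' - transfer D.+3 F t) <= theta * L * (t' - t) by lra.
  by apply: H1 => s s' s0 ss s1; have := LF s s' s0 ss s1; rewrite ler_norml => /andP[]; lra.
suff : -1 * (transfer D.+3 F t' - transfer D.+3 F t) <= theta * L * (t' - t) by lra.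
by apply: H2 => s s' s0 ss s1; have := LF s s' s0 ss s1; rewrite ler_norml => /andP[]; lra.
Qed.

Lemma theta01 : 0 <= theta < 1.
Proof. by rewrite /theta; apply/andP; split; lra. Qed.

Lemma transfer_iter_lip D L F n : 0 <= L -> lipschitz01 L F ->
  lipschitz01 (theta ^+ n * L) (iter n (transfer D.+3) F).
Proof.
move=> L0 LF; elim: n => [|n IH]; first by rewrite expr0 mul1r.
rewrite iterS exprS -mulrA; apply: transfer_contract => //.
by rewrite mulr_ge0 ?exprn_ge0 //; case/andP: theta01.
Qed.

End Chain.

(** * Cylinders and convergence to the Gauss measure *)

Section Cylinders.
Context {R : realType}.
Implicit Types (t x : R) (s w : seq nat).

(* Distribution function of the Gauss-map iterate given the state [t]. *)
Definition mob x t : R := (1 + t) * x / (1 + t * x).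

(** The endpoints of the cylinder of [s]; they swap at each digit because [next d] is decreasing. *)
Fixpoint hull s : R * R :=
  if s is d :: s' then (next d (hull s').2, next d (hull s').1) else (0, 1).

Lemma hull_bounds s : poss s ->
  [/\ 0 <= (hull s).1, (hull s).1 < (hull s).2 & (hull s).2 <= 1].
Proof.
elim: s => [|d s IH] /=; first by split; lra.
move=> /andP[d0 /IH[h1 h2 h3]]; have d1 := @ler1n_digit R _ d0; split.
- by rewrite invr_ge0 addr_ge0 //; lra.
- by rewrite /next ltf_pV2 ?posrE; lra.
- by rewrite /next invf_le1; lra.
Qed.

Lemma wt_digp_hull t s : poss s -> 0 <= t ->
  wt digp t s = mob (hull s).2 t - mob (hull s).1 t.
Proof.
elim: s t => [|d s IH] t /=.
  by move=> _ t0; rewrite /mob mulr0 mul0r subr0 !mulr1 divff //; lra.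
move=> /andP[d0 s0] t0; have d1 := @ler1n_digit R _ d0.
have [h1 h2 h3] := hull_bounds s0.
have n0 : 0 < next d t by rewrite invr_gt0; lra.
rewrite IH ?(ltW n0) // digpE // /mob /next.
move: (hull s).1 (hull s).2 h1 h2 h3 => a b a0 ab b1.
by field; do 5!(apply/andP; split; first by lra); lra.
Qed.

(** Each of the two [mob] terms increases in [t] with slope at most 1, so 2 is a safe constant for
    their difference. *)
Lemma wt_digp_lip s : poss s -> lipschitz01 2 (fun t => wt digp t s).
Proof.
move=> s0 t t' t0 tt t1; rewrite !wt_digp_hull ?(le_trans t0) //.
have [h1 h2 h3] := hull_bounds s0.
have mobB x : 0 <= x -> x <= 1 -> 0 <= mob x t' - mob x t <= t' - t.
  move=> x0 x1; have -> : mob x t' - mob x t = (t' - t) * (x * (1 - x) / ((1 + t * x) * (1 + t' * x))).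
    by rewrite /mob; field; apply/andP; split; nra.
  have tx : 0 <= t * x by rewrite mulr_ge0.
  have t'x : 0 <= t' * x by rewrite mulr_ge0 // (le_trans t0).
  have P : 1 <= (1 + t * x) * (1 + t' * x) by nra.
  apply/andP; split; first by rewrite mulr_ge0 ?subr_ge0 // divr_ge0 ?mulr_ge0 ?subr_ge0 //; nra.
  rewrite ler_piMr ?subr_ge0 // ler_pdivrMr; nra.
have := mobB _ h1 (ltW (lt_le_trans h2 h3)); have := mobB (hull s).2.
move=> /(_ (ltW (le_lt_trans h1 h2)) h3) /andP[? ?] /andP[? ?].
by rewrite ler_norml; apply/andP; split; lra.
Qed.

Lemma wt_digp01 t s : poss s -> in01 t -> 0 <= wt digp t s <= 1.
Proof.
move=> s0 /andP[t0 _]; rewrite wt_ge0 //=; last by move=> *; apply: digp_ge0.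
have digp1 d : forall t, (0 < d)%N -> 0 <= t -> digp d t <= 1.
  move=> t' d0 t'0; have d1 := @ler1n_digit R _ d0.
  by rewrite digpE // ler_pdivrMr ?mul1r; nra.
elim: s t s0 t0 => //= d s IH t /andP[d0 s0] t0.
have n0 : 0 <= next d t by rewrite invr_ge0 addr_ge0.
by rewrite mulr_ile1 ?digp_ge0 ?digp1 ?IH // wt_ge0 // => *; apply: digp_ge0.
Qed.

(** Closed form of the Gauss measure of the cylinder, which keeps integrals out of the mixing
    argument; [gauss_measure_cylinder] identifies the two. *)
Definition gauss_cyl s : R := (ln (1 + (hull s).2) - ln (1 + (hull s).1)) / ln 2.

Lemma ln2_gt0 : 0 < ln 2 :> R. Proof. by apply: ln_gt0; lra. Qed.

Lemma lnB_le (x y : R) : 0 < x -> x <= y -> ln y - ln x <= (y - x) / x.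
Proof.
move=> x0 xy; rewrite -ln_div ?posrE //; last lra.
have -> : y / x = 1 + (y - x) / x by field; lra.
apply: le_ln1Dx; have : 0 <= (y - x) / x by rewrite divr_ge0 ?subr_ge0 // ltW.
lra.
Qed.

Lemma lnB_ge (x y : R) : 0 < x -> x <= y -> (y - x) / y <= ln y - ln x.
Proof.
move=> x0 xy; have y0 : 0 < y by lra.
have : ln (x / y) <= - ((y - x) / y).
  have -> : x / y = 1 + - ((y - x) / y) by field; lra.
  apply: le_ln1Dx; rewrite ltrN2 ltr_pdivrMr //; lra.
rewrite ln_div ?posrE //; lra.
Qed.

Lemma gauss_cyl_ge0 s : poss s -> 0 <= gauss_cyl s.
Proof.
move=> /hull_bounds[h1 h2 h3]; rewrite divr_ge0 ?(ltW ln2_gt0) // subr_ge0.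
by rewrite ler_ln ?posrE; lra.
Qed.

Lemma gauss_cyl_le1 s : poss s -> gauss_cyl s <= 1.
Proof.
move=> /hull_bounds[h1 h2 h3]; rewrite ler_pdivrMr ?ln2_gt0 // mul1r.
have : ln (1 + (hull s).2) <= ln 2 by rewrite ler_ln ?posrE; lra.
have : 0 <= ln (1 + (hull s).1) by apply: ln_ge0; lra.
lra.
Qed.

(** Invariance of the Gauss measure under the Gauss map, cut off at digit [D]: since
    [ln(1 + 1/(d+x)) = ln(d+1+x) - ln(d+x)], the sum telescopes, and the correction is the mass of
    the digits above [D]. *)
Lemma gauss_cyl_sum D s : poss s ->
  \sum_(d <- iota 1 D) gauss_cyl (d :: s) =
  gauss_cyl s - (ln (D.+1%:R + (hull s).2) - ln (D.+1%:R + (hull s).1)) / ln 2.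
Proof.
move=> s0; have [h1 h2 h3] := hull_bounds s0; elim: D => [|D IH].
  by rewrite big_nil /gauss_cyl subrr.
rewrite big_iotaS IH /gauss_cyl /= /next.
have L x : 0 <= x -> ln (1 + (D.+1%:R + x)^-1) = ln (D.+2%:R + x) - ln (D.+1%:R + x).
  move=> x0; have d1 : 1 <= D.+1%:R :> R by rewrite ler1n.
  rewrite -ln_div ?posrE; [|rewrite -natr1; lra|lra].
  by congr ln; rewrite -(natr1 D.+1); field; lra.
rewrite !L; [ring|lra|lra].
Qed.

(** Up to the common factor [1/ln 2], the missing tail is at most [(b-a)/(D+1)] and the measure at
    least [(b-a)/2], so one digit loses at most the proportion [2/(D+1)]. *)
Lemma gauss_cyl_sum_bounds D s : poss s ->
  (1 - 2 / D.+1%:R) * gauss_cyl s <= \sum_(d <- iota 1 D) gauss_cyl (d :: s) <= gauss_cyl s.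
Proof.
move=> s0; have [h1 h2 h3] := hull_bounds s0; rewrite gauss_cyl_sum //.
have l2 := ln2_gt0; have D1 : 1 <= D.+1%:R :> R by rewrite ler1n.
set a := (hull s).1 in h1 h2 *; set b := (hull s).2 in h2 h3 *.
have e0 : 0 <= ln (D.+1%:R + b) - ln (D.+1%:R + a) by rewrite subr_ge0 ler_ln ?posrE; lra.
have e1 : ln (D.+1%:R + b) - ln (D.+1%:R + a) <= (b - a) / D.+1%:R.
  apply: le_trans (lnB_le _ _) _; try lra.
  have -> : D.+1%:R + b - (D.+1%:R + a) = b - a by ring.
  rewrite ler_wpM2l ?subr_ge0 ?(ltW h2) // lef_pV2 ?posrE; lra.
have e2 : (b - a) / 2 <= ln (1 + b) - ln (1 + a).
  apply: le_trans (lnB_ge _ _); try lra.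
  have -> : 1 + b - (1 + a) = b - a by ring.
  rewrite ler_wpM2l ?subr_ge0 ?(ltW h2) // lef_pV2 ?posrE; lra.
apply/andP; split; last by rewrite gerBl divr_ge0 // ltW.
rewrite mulrBl mul1r lerD2l lerN2 /gauss_cyl mulrA ler_wpM2r ?invr_ge0 ?(ltW l2) //.
apply: le_trans e1 _; rewrite -/a -/b.
have -> : (b - a) / D.+1%:R = 2 / D.+1%:R * ((b - a) / 2) by field; lra.
by rewrite ler_wpM2l // divr_ge0 //; lra.
Qed.

Lemma gauss_words_bounds D n s : (0 < D)%N -> poss s ->
  (1 - n%:R * (2 / D.+1%:R)) * gauss_cyl s <= \sum_(w <- words D n) gauss_cyl (w ++ s)
    <= gauss_cyl s.
Proof.
move=> D0 s0; have g0 := gauss_cyl_ge0 s0; elim: n => [|n IH].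
  by rewrite big_seq1 /= mul0r subr0 mul1r lexx.
set e := 2 / D.+1%:R in IH *.
have e0 : 0 <= e by rewrite divr_ge0.
have e1 : e <= 1 by rewrite ler_pdivrMr ?ltr0n // mul1r ler_nat.
have E : \sum_(w <- words D n.+1) gauss_cyl (w ++ s) =
    \sum_(w <- words D n) \sum_(d <- iota 1 D) gauss_cyl (d :: (w ++ s)).
  by rewrite /= big_allpairs_dep /= exchange_big.
have pos w : w \in words D n -> poss (w ++ s).
  by move=> /words_pos w0; rewrite /poss all_cat; apply/andP.
have ub : \sum_(w <- words D n.+1) gauss_cyl (w ++ s) <= \sum_(w <- words D n) gauss_cyl (w ++ s).
  rewrite E big_seq [leRHS]big_seq ler_sum // => w /pos ws.
  by case/andP: (gauss_cyl_sum_bounds D ws).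
have lb : (1 - e) * \sum_(w <- words D n) gauss_cyl (w ++ s) <=
    \sum_(w <- words D n.+1) gauss_cyl (w ++ s).
  rewrite E big_distrr big_seq [leRHS]big_seq ler_sum // => w /pos ws.
  by case/andP: (gauss_cyl_sum_bounds D ws).
case/andP: IH => IH1 IH2; apply/andP; split; last exact: le_trans IH2.
apply: le_trans lb; apply: le_trans (ler_wpM2l _ IH1); last by rewrite subr_ge0.
rewrite [leRHS]mulrA ler_wpM2r // -natr1.
have : 0 <= n%:R * e * e by rewrite !mulr_ge0.
lra.
Qed.

(** * Averaging over the state against the Gauss density *)

Lemma is_derive_ln_affine (b t : R) : 0 < 1 + t * b ->
  is_derive t 1 (fun u => ln (1 + u * b)) (b / (1 + t * b)).
Proof.
move=> tb; have D1 : is_derive t 1 (fun u : R => 1 + u * b) b.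
  refine (is_derive_eq (is_deriveD (is_derive_cst (1 : R) t 1)
    (is_deriveM (is_derive_id t 1) (is_derive_cst b t 1))) _).
  by rewrite /= scaler0 !add0r /GRing.scale /= mulr1.
refine (is_derive_eq (@is_derive1_comp R (@ln R) (fun u => 1 + u * b) t _ _ (is_derive1_ln tb) D1) _).
by rewrite mulrC.
Qed.

(* ln(1+b) - ln(1+a) is the integral over [0,1] of (mob b t - mob a t)/(1+t). *)
Lemma gauss_cyl_pos (sg M : R) (r : seq (seq nat)) :
  (forall w, w \in r -> poss w) ->
  (forall t, in01 t -> 0 <= sg * (M - \sum_(w <- r) wt digp t w)) ->
  0 <= sg * (M - \sum_(w <- r) gauss_cyl w).
Proof.
move=> r0 pos.
pose h w t : R := ln (1 + t * (hull w).2) - ln (1 + t * (hull w).1).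
(* [H] vanishes at 0, equals the claimed quantity times [ln 2] at 1, and its derivative at [t] is
   the assumed nonnegative quantity divided by [1+t]. The sign [sg] lets one statement serve for
   upper and lower bounds. *)
pose H t : R := sg * (M * ln (1 + t * 1) - \sum_(w <- r) h w t).
pose dH t : R := sg * (M * (1 / (1 + t * 1)) -
  \sum_(w <- r) ((hull w).2 / (1 + t * (hull w).2) - (hull w).1 / (1 + t * (hull w).1))).
have derH t : in01 t -> is_derive t 1 H (dH t).
  move=> /andP[t0 t1].
  have dh : is_derive t 1 (fun u => \sum_(w <- r) h w u)
     (\sum_(w <- r) ((hull w).2 / (1 + t * (hull w).2) - (hull w).1 / (1 + t * (hull w).1))).
    elim: r r0 {pos H dH} => [|w r IH] r0.
      under eq_fun do rewrite big_nil; rewrite big_nil; exact: is_derive_cst.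
    under eq_fun do rewrite big_cons; rewrite big_cons.
    have [h1 h2 h3] := hull_bounds (r0 w (mem_head _ _)).
    apply: is_deriveD; last by apply: IH => v vr; apply: r0; rewrite in_cons vr orbT.
    by apply: is_deriveB; apply: is_derive_ln_affine; nra.
  apply: is_deriveZ; apply: is_deriveB => //; apply: is_deriveZ.
  by apply: is_derive_ln_affine; lra.
have dH0 t : in01 t -> 0 <= dH t.
  move=> t01; have /andP[t0 t1] := t01; have := pos t t01.
  suff -> : sg * (M - \sum_(w <- r) wt digp t w) = (1 + t) * dH t by rewrite pmulr_rge0; lra.
  rewrite /dH mulr1 mulrCA; congr (_ * _).
  rewrite mulrBr; congr (_ - _); first by field; lra.
  rewrite big_distrr; apply: eq_big_seq => w /r0 w0 /=.
  have [h1 h2 h3] := hull_bounds w0.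
  by rewrite wt_digp_hull // /mob mulrBr !mulrA.
have [//||c c01 Hc] := @MVT_segment R H dH 0 1 ler01.
- by move=> x; rewrite in_itv /= => /andP[x0 x1]; apply: derH; rewrite /in01 !ltW.
- apply: derivable_within_continuous => x; rewrite in_itv /= => x01.
  exact: (@ex_derive _ _ _ _ _ _ _ (derH x x01)).
have : 0 <= H 1 - H 0 by rewrite Hc subr0 mulr1; apply: dH0; move: c01; rewrite in_itv.
have -> : H 0 = 0.
  rewrite /H mul0r addr0 ln1 mulr0 big1 ?subr0 ?mulr0 // => w _.
  by rewrite /h !mul0r addr0 ln1 subrr.
have -> : H 1 = sg * (M - \sum_(w <- r) gauss_cyl w) * ln 2.
  rewrite /H mul1r -mulrA; congr (_ * _); rewrite mulrBl; congr (_ - _).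
  rewrite big_distrl; apply: eq_bigr => w _ /=; rewrite /gauss_cyl /h !mul1r divfK //.
  exact/lt0r_neq0/ln2_gt0.
by rewrite subr0 pmulr_lge0 // ln2_gt0.
Qed.

Lemma digp_sum_ge D t : in01 t -> 1 - 2 / D.+1%:R <= \sum_(d <- iota 1 D) digp d t.
Proof.
move=> /andP[t0 t1]; have -> : \sum_(d <- iota 1 D) digp d t = 1 - tailp D.+1 t.
  elim: D => [|n IH]; first by rewrite big_nil tailp1 // subrr.
  rewrite big_iotaS IH /digp; ring.
have D1 : 1 <= D.+1%:R :> R by rewrite ler1n.
rewrite lerD2l lerN2 /tailp ler_pM ?addr_ge0 ?invr_ge0 ?addr_ge0 //; first lra.
rewrite lef_pV2 ?posrE; lra.
Qed.

Lemma digp_words_ge D n t : (0 < D)%N -> in01 t ->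
  1 - n%:R * (2 / D.+1%:R) <= \sum_(w <- words D n) wt digp t w.
Proof.
move=> D0.
have -> : \sum_(w <- words D n) wt digp t w = Ex digp D n t (fun=> 1).
  by rewrite /Ex; apply: eq_bigr => w _; rewrite mulr1.
elim: n t => [|n IH] t t01; first by rewrite Ex0 mul0r subr0.
set e := 2 / D.+1%:R in IH *.
have e0 : 0 <= e by rewrite divr_ge0.
have [ne|ne] := leP (1 - n.+1%:R * e) 0.
  apply: (le_trans ne); rewrite /Ex big_seq sumr_ge0 // => w /words_pos w0.
  by rewrite mulr1; have /andP[] := wt_digp01 w0 t01.
rewrite ExS; apply: (@le_trans _ _ (\sum_(d <- iota 1 D) digp d t * (1 - n%:R * e))).
  rewrite -big_distrl /=; have := digp_sum_ge D t01; rewrite -/e => S.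
  have n0 : 0 <= n%:R * e by rewrite mulr_ge0.
  move: ne; rewrite -natr1 => ne.
  apply: (@le_trans _ _ ((1 - e) * (1 - n%:R * e))); last by rewrite ler_wpM2r //; lra.
  have : 0 <= n%:R * e * e by rewrite !mulr_ge0.
  lra.
rewrite big_seq [leRHS]big_seq ler_sum // => d; rewrite mem_iota => /andP[d0 _].
case/andP: (t01) => t0 _.
by rewrite ler_wpM2l ?digp_ge0 // IH //; apply: next01.
Qed.

Lemma Ex_digp_wt D n t s :
  Ex digp D n t (fun u => wt digp (walk t u) s) = \sum_(w <- words D n) wt digp t (w ++ s).
Proof. by rewrite /Ex; apply: eq_bigr => w _; rewrite wt_cat. Qed.

(** Capped weights dominate the true ones and sum to 1, while the true ones sum to at least
    [1 - 2n/(D+2)]; the integrated function lies in [0,1]. *)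
Lemma Ex_capp_digp D n t s : in01 t -> poss s ->
  0 <= Ex (capp D.+1) D.+1 n t (fun u => wt digp (walk t u) s) -
    \sum_(w <- words D.+1 n) wt digp t (w ++ s) <= n%:R * (2 / D.+2%:R).
Proof.
move=> t01 s0; have /andP[t0 t1] := t01.
rewrite -Ex_digp_wt /Ex -sumrB.
have B w : w \in words D.+1 n ->
   0 <= wt (capp D.+1) t w * wt digp (walk t w) s - wt digp t w * wt digp (walk t w) s
     <= wt (capp D.+1) t w * 1 - wt digp t w.
  move=> /words_pos w0; have := wt_digp01 s0 (walk01 w0 t01) => /andP[g0 g1].
  have le := wt_digp_le_capp D.+1 w0 t0.
  by rewrite -mulrBl mulr1 mulr_ge0 ?subr_ge0 //= ler_piMr ?subr_ge0.
apply/andP; split.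
  by rewrite big_seq sumr_ge0 // => w /B /andP[].
apply: (@le_trans _ _ (\sum_(w <- words D.+1 n) (wt (capp D.+1) t w * 1 - wt digp t w))).
  by rewrite big_seq [leRHS]big_seq ler_sum // => w /B /andP[].
rewrite sumrB -/(Ex (capp D.+1) D.+1 n t (fun=> 1)) Ex1 //.
by rewrite lerBlDr -lerBlDl digp_words_ge.
Qed.

(** The iterate [G] oscillates by at most [2 theta^n], and up to capping its Gauss average is
    [gauss_cyl s] by invariance. [gauss_cyl_pos], used with both signs, passes from the pointwise
    comparison to averages, so [G] is near [gauss_cyl s] at every state. *)
Lemma transfer_iter_cvg D n t s : in01 t -> poss s ->
  `|iter n (transfer D.+3) (fun t => wt digp t s) t - gauss_cyl s| <=
  2 * theta ^+ n + n%:R * (2 / D.+4%:R).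
Proof.
move=> t01 s0; set e := n%:R * _.
pose G := iter n (transfer D.+3) (fun t => wt digp t s).
have osc t' : in01 t' -> `|G t - G t'| <= 2 * theta ^+ n.
  move=> /andP[t'0 t'1]; case/andP: t01 => t0 t1.
  have H a b : 0 <= a -> a <= b -> b <= 1 -> `|G a - G b| <= 2 * theta ^+ n.
    move=> a0 ab b1; have L2 : lipschitz01 (theta ^+ n * 2) G.
      by apply: transfer_iter_lip => //; apply: wt_digp_lip.
    apply: le_trans (L2 a b a0 ab b1) _; rewrite [2 * _]mulrC; apply: ler_piMr; last lra.
    by rewrite mulr_ge0 // exprn_ge0 //; case/andP: (@theta01 R).
  by have [tt|/ltW tt] := leP t t'; last rewrite distrC; apply: H.
have A t' : in01 t' -> 0 <= G t' - \sum_(w <- words D.+3 n) wt digp t' (w ++ s) <= e.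
  by move=> t'01; rewrite /G transfer_iter; apply: Ex_capp_digp.
have pos w : w \in words D.+3 n -> poss (w ++ s).
  by move=> /words_pos w0; rewrite /poss all_cat; apply/andP.
have [g0 g1] := (gauss_cyl_ge0 s0, gauss_cyl_le1 s0).
have /andP[B1 B2] := gauss_words_bounds n (ltn0Sn D.+2) s0.
have e0 : 0 <= e by rewrite /e mulr_ge0 // divr_ge0.
have mapE (F : seq nat -> R) : \sum_(w <- [seq w ++ s | w <- words D.+3 n]) F w =
    \sum_(w <- words D.+3 n) F (w ++ s) by rewrite big_map.
have posr w : w \in [seq w ++ s | w <- words D.+3 n] -> poss w.
  by move=> /mapP[v /pos ? ->].
have up := @gauss_cyl_pos 1 (G t + 2 * theta ^+ n) _ posr.
have lo := @gauss_cyl_pos (-1) (G t - 2 * theta ^+ n - e) _ posr.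
rewrite !mapE in up lo.
rewrite ler_norml -/(G t); apply/andP; split.
  suff : 0 <= 1 * (G t + 2 * theta ^+ n - \sum_(w <- words D.+3 n) gauss_cyl (w ++ s)).
    have : e * gauss_cyl s <= e by rewrite ler_piMr.
    by move: B1; rewrite -/e; lra.
  apply: up => t' t'01; rewrite mapE mul1r.
  have /andP[A1 _] := A _ t'01; have := osc t' t'01; rewrite ler_norml => /andP[]; lra.
suff : 0 <= -1 * (G t - 2 * theta ^+ n - e - \sum_(w <- words D.+3 n) gauss_cyl (w ++ s)) by lra.
apply: lo => t' t'01; rewrite mapE.
have /andP[_ A1] := A _ t'01; have := osc t' t'01; rewrite ler_norml => /andP[]; lra.
Qed.

End Cylinders.

(** * Variance of the number of occurrences *)

Fixpoint cnt (s w : seq nat) : nat :=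
  if w is d :: w' then (prefix s (d :: w') + cnt s w')%N else 0%N.

Lemma prefix_cat_size (s v w : seq nat) : (size s <= size v)%N -> prefix s (v ++ w) = prefix s v.
Proof.
by move=> sv; rewrite !prefixE take_cat; case: ltngtP sv => // -> _; rewrite subnn take0 cats0 take_size.
Qed.

(** The full series is [2/(1 - theta) = 512/3], just below 171. *)
Lemma geometric_theta (R : realFieldType) n : \sum_(i <- iota 0 n) 2 * theta ^+ i <= 171 :> R.
Proof.
suff : \sum_(i <- iota 0 n) 2 * theta ^+ i + 512 / 3 * theta ^+ n = 512 / 3 :> R.
  have : 0 <= theta ^+ n :> R by rewrite exprn_ge0 //; case/andP: (@theta01 R).
  lra.
elim: n => [|n IH]; first by rewrite big_nil expr0; lra.
rewrite -[RHS]IH -{1}(addn1 n) iotaD big_cat big_seq1 add0n exprS /=.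
by move: (theta ^+ n) => X; rewrite /theta; lra.
Qed.

Section Variance.
Context {R : realType}.
Variables (s : seq nat) (D : nat).
Hypothesis s_gt0 : (0 < size s)%N.
Hypothesis s_pos : poss s.
(** Below the cap [D+3] the laws [capp] and [digp] agree, so reading [s] has its true
    probability. *)
Hypothesis s_lt : all (fun d => d < D.+3)%N s.

Let c : R := gauss_cyl s.
Let l := size s.
Let P := @capp R D.+3.
Let E k t (F : seq nat -> R) := Ex P D.+3 k t F.

Definition dev (u : seq nat) : R := (cnt s u)%:R - c * (size u)%:R.
Let Y (u : seq nat) : R := (prefix s u)%:R - c.

Let Y_le1 u : `|Y u| <= 1.
Proof.
have := gauss_cyl_ge0 (R := R) s_pos; have := gauss_cyl_le1 (R := R) s_pos.
by rewrite /Y /c ler_norml; case: (prefix s u) => /= *; apply/andP; split; lra.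
Qed.

Let dev_cons d u : dev (d :: u) = Y (d :: u) + dev u.
Proof. rewrite /dev /Y /= natrD -[(size u).+1]addn1 natrD; ring. Qed.

Lemma dev_cat_dist v u : `|dev (v ++ u) - dev u| <= (size v)%:R.
Proof.
elim: v => [|d v IH] /=; first by rewrite subrr normr0.
rewrite dev_cons -addrA -natr1 addrC (le_trans (ler_normD _ _)) // lerD //.
Qed.

Lemma dev_le_size u : `|dev u| <= (size u)%:R.
Proof. by have := dev_cat_dist u [::]; rewrite cats0 /dev /= mulr0 !subr0. Qed.

Let dev_drop n u : (n <= size u)%N ->
  dev u = \sum_(i <- iota 0 n) Y (drop i u) + dev (drop n u).
Proof.
elim: n => [|n IH] nu; first by rewrite big_nil add0r drop0.
rewrite IH ?(ltnW nu) // -addn1 iotaD big_cat big_seq1 add0n addn1 -addrA /=.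
by rewrite (drop_nth 0%N nu) dev_cons.
Qed.

Let E_drop i k t (F : seq nat -> R) : E (i + k) t (fun u => F (drop i u)) =
  E i t (fun v => E k (walk t v) F).
Proof.
rewrite /E Ex_cat; apply: eq_Ex => v; rewrite in_words => /andP[/eqP vi _].
by apply: eq_Ex => w _; rewrite -vi drop_size_cat.
Qed.

Let E_Y k (t : R) : (l <= k)%N -> 0 <= t -> E k t Y = wt digp t s - c.
Proof.
move=> lk t0; rewrite /E /Y.
transitivity (E k t (fun u => (prefix s u)%:R + (- c))); first by [].
rewrite /E ExD Ex_const // Ex_prefix //; last first.
  rewrite in_words eqxx /=; move: s_pos s_lt => /allP h1 /allP h2; apply/allP => d ds.
  by rewrite h1 //= ltnW // h2.
congr (_ - _); elim: s s_lt t {lk t0} => //= d w IH /andP[dD wD] t.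
by rewrite IH // /P /capp dD.
Qed.

Let KA : R := l%:R + 172.

(** The position [i] has mean error at most [2 theta^i] plus a capping error. In [KA = l + 172], the
    geometric series takes 171, the capping errors take 1 because [2 k^2 <= D], and the last [l]
    positions take [l]. *)
Lemma Ex_dev_bound k t : (2 * k ^ 2 <= D)%N -> in01 t -> `|E k t dev| <= KA.
Proof.
move=> kD t01; have /andP[t0 t1] := t01.
have [kl|lk] := leqP k l.
  apply: le_norm_Ex => // u; rewrite in_words => /andP[/eqP uk _].
  apply: le_trans (dev_le_size u) _; rewrite uk.
  by apply: (@le_trans _ _ l%:R); rewrite ?ler_nat // lerDl.
pose n := (k - l)%N; have kE : k = (n + l)%N by rewrite /n; lia.
have -> : E k t dev = \sum_(i <- iota 0 n) E k t (fun u => Y (drop i u)) +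
    E k t (fun u => dev (drop n u)).
  rewrite /E -Ex_sum -ExD; apply: eq_Ex => u; rewrite in_words => /andP[/eqP uk _].
  by rewrite -dev_drop // uk kE; lia.
rewrite (le_trans (ler_normD _ _)) // [KA]addrC lerD //; last first.
  apply: le_norm_Ex => // u; rewrite in_words => /andP[/eqP uk _].
  by apply: le_trans (dev_le_size _) _; rewrite size_drop uk ler_nat; lia.
have bnd i : (i < n)%N -> `|E k t (fun u => Y (drop i u))| <= 2 * theta ^+ i + i%:R * (2 / D.+4%:R).
  move=> ilt; have -> : k = (i + (k - i))%N by lia.
  rewrite E_drop.
  have -> : E i t (fun v => E (k - i) (walk t v) Y) =
      iter i (transfer D.+3) (fun t => wt digp t s) t - c.
    rewrite transfer_iter -[c in RHS](Ex_const D.+2 i c t0) -mulN1r -ExZ -ExD.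
    apply: eq_Ex => v hv; rewrite E_Y; [by rewrite mulN1r| lia | exact: walk_ge0].
  exact: transfer_iter_cvg.
have ksum : \sum_(i <- iota 0 n) (i%:R * (2 / D.+4%:R)) <= 1 :> R.
  apply: (@le_trans _ _ (\sum_(i <- iota 0 n) (k%:R * (2 / D.+4%:R)))).
    rewrite big_seq [leRHS]big_seq ler_sum // => i; rewrite mem_iota => ilt.
    by rewrite ler_wpM2r ?divr_ge0 // ler_nat; lia.
  rewrite big_const_seq count_predT size_iota iter_addr_0 -[leLHS]mulr_natr.
  have -> : k%:R * (2 / D.+4%:R) * n%:R = (n * k * 2)%N%:R / D.+4%:R :> R.
    by rewrite !natrM; ring.
  rewrite ler_pdivrMr ?ltr0n // mul1r ler_nat.
  have : (n * k <= k * k)%N by rewrite leq_mul2r; lia.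
  by move: kD; rewrite -mulnn; lia.
apply: le_trans (ler_norm_sum _ _ _) _.
apply: (@le_trans _ _ (\sum_(i <- iota 0 n) (2 * theta ^+ i + i%:R * (2 / D.+4%:R)))).
  rewrite big_seq [leRHS]big_seq ler_sum // => i; rewrite mem_iota => ilt.
  by apply: bnd; lia.
rewrite big_split /=; have := geometric_theta R n; lra.
Qed.

(** The positions overlapping the first window cost at most [l], as [Y] is bounded by 1. Beyond the
    window the Markov property applies: given the state after [l] digits, the mean of the remaining
    deviation is at most [KA]. *)
Let cross_bound k t : (2 * k.+1 ^ 2 <= D)%N -> in01 t ->
  `|E k.+1 t (fun u => Y u * dev (behead u))| <= l%:R + KA.
Proof.
move=> kD t01; have /andP[t0 t1] := t01.
have KA0 : 0 <= KA by rewrite /KA addr_ge0.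
have [kl|lk] := leqP k.+1 l.
  apply: le_norm_Ex => // u; rewrite in_words => /andP[/eqP uk _].
  rewrite normrM (le_trans (ler_piMl _ (Y_le1 _))) //.
  apply: le_trans (dev_le_size _) _; rewrite size_behead uk /=.
  have : k%:R <= l%:R :> R by rewrite ler_nat; lia.
  lra.
pose n := (k.+1 - l)%N; have kE : k.+1 = (l + n)%N by rewrite /n; lia.
have -> : E k.+1 t (fun u => Y u * dev (behead u)) =
   E k.+1 t (fun u => Y u * (dev (behead u) - dev (drop l u))) +
   E k.+1 t (fun u => Y u * dev (drop l u)).
  by rewrite /E -ExD; apply: eq_Ex => u _; ring.
apply: le_trans (ler_normD _ _) _; apply: lerD.
  apply: le_norm_Ex => // u; rewrite in_words => /andP[/eqP uk _].
  rewrite normrM (le_trans (ler_piMl _ (Y_le1 _))) //.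
  have -> : drop l u = drop l.-1 (behead u) by rewrite -drop1 drop_drop addn1 prednK // s_gt0.
  rewrite -{1}(cat_take_drop l.-1 (behead u)).
  apply: le_trans (dev_cat_dist _ _) _; rewrite ler_nat size_take size_behead uk /=.
  by case: ifP; lia.
have -> : E k.+1 t (fun u => Y u * dev (drop l u)) = E l t (fun v => Y v * E n (walk t v) dev).
  rewrite /E kE Ex_cat; apply: eq_Ex => v; rewrite in_words => /andP[/eqP vl _].
  rewrite -ExZ; apply: eq_Ex => w _; rewrite drop_size_cat //; congr (_ * _).
  by rewrite /Y prefix_cat_size // vl.
apply: le_norm_Ex => // v /words_pos v0.
rewrite normrM (le_trans (ler_piMl _ (Y_le1 _))) //; apply: Ex_dev_bound; last exact: walk01.
by apply: leq_trans kD; rewrite leq_mul2l leq_exp2r //; lia.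
Qed.

(** Squaring [dev (d :: u) = Y (d :: u) + dev u] shows that each digit adds at most 1 for the square
    of [Y] and [2 (l + KA)] for the cross term, so the second moment grows linearly. *)
Lemma Ex_dev_sq k t : (2 * k ^ 2 <= D)%N -> in01 t ->
  E k t (fun u => dev u ^+ 2) <= k%:R * (1 + 2 * (l%:R + KA)).
Proof.
elim: k t => [|k IH] t kD t01; have /andP[t0 t1] := t01.
  by rewrite /E Ex0 /dev /= mulr0 subr0 expr0n mul0r.
have -> : E k.+1 t (fun u => dev u ^+ 2) = E k.+1 t (fun u => Y u ^+ 2) +
    2 * E k.+1 t (fun u => Y u * dev (behead u)) + E (1 + k) t (fun u => dev (drop 1 u) ^+ 2).
  rewrite /E -ExZ -!ExD; apply: eq_Ex => -[|d u]; rewrite in_words //= => _.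
  rewrite dev_cons drop0; ring.
rewrite (E_drop 1 k t (fun u => dev u ^+ 2)) -(natr1 k) [leRHS]mulrDl mul1r addrC lerD //.
  rewrite -[leRHS](Ex_const D.+2 1 _ t0); apply: le_Ex => // v /words_pos v0.
  apply: IH; last exact: walk01.
  by apply: leq_trans kD; rewrite leq_mul2l leq_exp2r // leqnSn.
have := cross_bound kD t01; rewrite ler_norml => /andP[_ cb].
rewrite lerD //; last by rewrite ler_pM2l.
rewrite -[leRHS](Ex_const D.+2 k.+1 _ t0); apply: le_Ex => // u _.
by rewrite -real_normK ?num_real // expr_le1.
Qed.

Lemma Chebyshev_dev k t a : (2 * k ^ 2 <= D)%N -> in01 t -> 0 < a ->
  E k t (fun u => (a < `|dev u|)%R%:R) <= k%:R * (4 * l%:R + 345) / a ^+ 2.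
Proof.
move=> kD t01 a0; have /andP[t0 t1] := t01.
rewrite ler_pdivlMr ?exprn_gt0 // mulrC.
have := Ex_dev_sq kD t01; have -> : 1 + 2 * (l%:R + KA) = 4 * l%:R + 345 by rewrite /KA; ring.
apply: le_trans; rewrite /E -ExZ; apply: le_Ex => // u _.
have [au|_] := ltP a `|dev u|; last by rewrite mulr0 sqr_ge0.
by rewrite mulr1 -[leRHS]real_normK ?num_real // ler_pXn2r ?nnegrE ?(ltW a0) ?(ltW au).
Qed.

End Variance.

(** * Counting words with bounded continuant *)

Lemma ler_sum_sub (R : numDomainType) (T : eqType) (r1 r2 : seq T) (F : T -> R) :
  uniq r1 -> {subset r1 <= r2} -> (forall x, x \in r2 -> 0 <= F x) ->
  \sum_(x <- r1) F x <= \sum_(x <- r2) F x.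
Proof.
elim: r1 r2 => [|x r1 IH] r2 /=; first by rewrite big_nil big_seq => _ _ F0; apply: sumr_ge0.
move=> /andP[xr1 u1] sub F0; have xr2 : x \in r2 by apply: sub; rewrite mem_head.
rewrite (perm_big _ (perm_to_rem xr2)) !big_cons lerD2l; apply: IH => // y.
  move=> yr1; have := sub y; rewrite in_cons yr1 orbT => /(_ isT).
  rewrite (perm_mem (perm_to_rem xr2)) in_cons => /orP[/eqP yx|//].
  by rewrite -yx yr1 in xr1.
by move=> /mem_rem /F0.
Qed.

(* [numden w] is the reduced fraction with digits [w], so [(numden w).2] is the
   continuant of [w]; [qst w] is the pair of the last two convergent
   denominators. *)
Fixpoint numden (w : seq nat) : nat * nat :=
  if w is a :: w' then ((numden w').2, (a * (numden w').2 + (numden w').1)%N) else (0, 1)%N.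
Definition den w := (numden w).2.

Definition qstep (x : nat * nat) (a : nat) : nat * nat := (x.2, (a * x.2 + x.1)%N).
Definition qst (w : seq nat) : nat * nat := foldl qstep (0, 1)%N w.

(** Links the continuant recursion from the last digit ([numden]) with the one from the first digit
    ([qst]); the general start pair is what the induction requires. *)
Lemma foldl_qstep x w : (foldl qstep x w).2 = (x.2 * den w + x.1 * (numden w).1)%N.
Proof.
elim: w x => [|a w IH] [x' x] /=; first by rewrite /den /= muln1 muln0 addn0.
rewrite IH /den /=; ring.
Qed.

Lemma qst_den w : (qst w).2 = den w.
Proof. by rewrite /qst foldl_qstep /= mul1n mul0n addn0. Qed.

Lemma den_gt0 w : poss w -> (0 < den w)%N.
Proof. by elim: w => //= a w IH /andP[a0 /IH]; rewrite /den /=; lia. Qed.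

Lemma qst_le w : poss w -> ((qst w).1 <= (qst w).2)%N.
Proof.
rewrite /qst; have : (0 <= 1)%N by []; elim: w (0%N) (1%N) => //= a w IH x' x xx /andP[a0 w0].
by apply: IH => //=; nia.
Qed.

(** With start pair (0,1) this is the classical cylinder length [1/(q(q+q'))], where [q] and [q']
    are the last two convergent denominators. *)
Lemma wt_digp_qst (R : realFieldType) x' x w : (0 < x)%N -> poss w ->
  wt (digp (R := R)) (x'%:R / x%:R) w =
  x%:R * (x%:R + x'%:R) / ((foldl qstep (x', x) w).2%:R *
    ((foldl qstep (x', x) w).2%:R + (foldl qstep (x', x) w).1%:R)).
Proof.
elim: w x' x => [|a w IH] x' x x0 /=.
  have : 0 < x%:R :> R by rewrite ltr0n.
  have : 0 <= x'%:R :> R by [].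
  by move=> h1 h2 _; rewrite divff // mulf_neq0; lra.
move=> /andP[a0 w0].
have X0 : 0 < x%:R :> R by rewrite ltr0n.
have X'0 : 0 <= x'%:R :> R by [].
have A0 : 1 <= a%:R :> R by rewrite ler1n.
have Q0 : 0 < a%:R * x%:R + x'%:R :> R by nra.
rewrite digpE ?divr_ge0 //.
have -> : next a (x'%:R / x%:R) = x%:R / (a * x + x')%N%:R :> R.
  by rewrite /next natrD natrM; field; apply/andP; split; lra.
rewrite IH //; last by nia.
set Q := foldl _ _ _.
have [QQ|QQ] := eqVneq (Q.2%:R * (Q.2%:R + Q.1%:R) : R) 0.
  by rewrite QQ invr0 !mulr0.
rewrite natrD natrM !mulrA; congr (_ / _).
field; repeat (apply/andP; split); nra.
Qed.

Lemma wt_digp_den (R : realFieldType) w : poss w ->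
  (2 * (den w)%:R ^+ 2)^-1 <= wt (digp (R := R)) 0 w.
Proof.
move=> w0; have := @wt_digp_qst R 0 1 w isT w0; rewrite mul0r addr0 !mul1r => ->.
have -> : foldl qstep (0, 1)%N w = qst w by [].
have := qst_le w0; have := den_gt0 w0; rewrite -qst_den; case: (qst w) => q' q /= q0 qq.
have Q0 : 0 < q%:R :> R by rewrite ltr0n.
have QQ : q'%:R <= q%:R :> R by rewrite ler_nat.
have Q'0 : 0 <= q'%:R :> R by [].
by rewrite lef_pV2 ?posrE; nra.
Qed.

Lemma den_cons a w : den (a :: w) = (a * den w + (numden w).1)%N.
Proof. by []. Qed.

Lemma den_consW a w : (a * den w <= den (a :: w))%N.
Proof. by rewrite den_cons leq_addr. Qed.

(** Two further digits at least double the continuant. *)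
Lemma den_pow w : poss w -> (2 ^ (size w)./2 <= den w)%N.
Proof.
elim: {w}(size w).+1 {-2}w (ltnSn (size w)) => // n IH [|a [|b w]] //= sz.
  by rewrite andbT expn0 /den /= muln1 addn0.
move=> /and3P[a0 b0 w0]; have := IH w; rewrite w0 => /(_ _ isT) H.
have {}H : (2 ^ (size w)./2 <= den w)%N by apply: H; lia.
rewrite expnS; apply: leq_trans (_ : 2 * den w <= _)%N; first by rewrite leq_mul2l.
rewrite /den /=; case: (numden w) => n' d /=.
have := leq_pmull d b0; have := leq_pmull (b * d + n') a0; lia.
Qed.

Lemma digit_le_den w d : poss w -> d \in w -> (d <= den w)%N.
Proof.
elim: w => //= a w IH /andP[a0 w0]; have dw := den_gt0 w0; have := den_consW a w.
rewrite in_cons => H /orP[/eqP ->|/(IH w0) IHd]; nia.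
Qed.

(** If [q''] is the next denominator after [q', q], then [q'' >= q + q'], so [q''(q''+q)] exceeds
    [q''^2] by at least [q(q+q')]; this closes the induction. *)
Lemma sum_den_take u : poss u ->
  (\sum_(j <- iota 0 (size u).+1) den (take j u) ^ 2 <= (qst u).2 * ((qst u).2 + (qst u).1))%N.
Proof.
elim/last_ind: u => [|u a IH]; first by rewrite /= big_seq1.
rewrite /poss all_rcons => /andP[a0 u0]; rewrite size_rcons.
rewrite -[(size u).+2]addn1 iotaD big_cat big_seq1 add0n /=.
have -> : take (size u).+1 (rcons u a) = rcons u a by rewrite -(size_rcons u a) take_size.
have -> : (\sum_(j <- iota 0 (size u).+1) den (take j (rcons u a)) ^ 2 =
   \sum_(j <- iota 0 (size u).+1) den (take j u) ^ 2)%N.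
  apply: eq_big_seq => j; rewrite mem_iota => jlt; congr (den _ ^ 2)%N.
  by rewrite -cats1 takel_cat //; lia.
move: (IH u0); rewrite -qst_den /qst foldl_rcons -/(qst u) /qstep; case: (qst u) => q' q /=.
nia.
Qed.

(** Last digits are peeled off while the continuant exceeds [m], since those prefixes contribute
    nothing. Once it is at most [m], [sum_den_take] gives [q(q+q') <= 2 m^2]. *)
Lemma sum_den_take_le u m : poss u ->
  (\sum_(j <- iota 0 (size u).+1 | (den (take j u) <= m)%N) den (take j u) ^ 2 <= 2 * m ^ 2)%N.
Proof.
elim/last_ind: u => [|u a IH] u0.
  by rewrite /= big_cons big_nil /den /=; case: ifP => //; nia.
have [am|am] := leqP (den (rcons u a)) m.
  apply: leq_trans (_ : \sum_(j <- iota 0 (size (rcons u a)).+1) den (take j (rcons u a)) ^ 2 <= _)%N.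
    by rewrite [leqRHS](bigID (fun j => den (take j (rcons u a)) <= m)%N) /= leq_addr.
  apply: leq_trans (sum_den_take u0) _.
  have := qst_le u0; move: am; rewrite -qst_den; case: (qst _) => q' q /=; nia.
move: u0; rewrite /poss all_rcons => /andP[a0 u0].
rewrite size_rcons -[(size u).+2]addn1 iotaD big_cat.
rewrite [X in (_ + X <= _)%N]big_cons big_nil add0n.
have -> : take (size u).+1 (rcons u a) = rcons u a by rewrite -(size_rcons u a) take_size.
rewrite [(den (rcons u a) <= m)%N]leqNgt am addn0; apply: leq_trans (IH u0).
rewrite big_seq_cond [leqRHS]big_seq_cond; apply: eq_leq.
have E j : j \in iota 0 (size u).+1 -> take j (rcons u a) = take j u.
  by rewrite mem_iota => jlt; rewrite -cats1 takel_cat //; lia.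
by apply: eq_big => j; [case: (boolP (j \in _)) => //= /E ->|move=> /andP[/E -> _]].
Qed.

Lemma sum_den_prefix (B : seq (seq nat)) u m : uniq B -> poss u ->
  (forall w, w \in B -> den w <= m)%N ->
  (\sum_(w <- B | prefix w u) den w ^ 2 <= 2 * m ^ 2)%N.
Proof.
move=> uB u0 Bm; apply: leq_trans (sum_den_take_le m u0).
rewrite -big_filter -[leqRHS]big_filter -(big_map (fun j => take j u) xpredT (fun w => den w ^ 2)%N).
apply: (@uniq_sub_le_big _ addn leq leqnn (fun x y => leq_addr y x)); rewrite ?filter_uniq //.
- rewrite map_inj_in_uniq ?filter_uniq ?iota_uniq // => i j.
  rewrite !mem_filter !mem_iota => /andP[_ hi] /andP[_ hj] /(congr1 size).
  by rewrite !size_takel //; lia.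
- move=> w; rewrite mem_filter => /andP[pw wB]; apply/mapP; exists (size w).
    have wu := size_prefix pw; move: pw; rewrite prefixE => /eqP pw.
    by rewrite mem_filter mem_iota pw Bm.
  by move: pw; rewrite prefixE => /eqP ->.
Qed.

(** * Occurrences in a word extended on the right *)

Lemma cnt_cons s d w : cnt s (d :: w) = (prefix s (d :: w) + cnt s w)%N.
Proof. by []. Qed.

Lemma cnt_small s w : (size w < size s)%N -> cnt s w = 0%N.
Proof.
elim: w => // d w IH ws; rewrite cnt_cons IH ?(ltnW ws) // addn0.
by case: (boolP (prefix s (d :: w))) => // p; have := size_prefix p; rewrite leqNgt ws.
Qed.

Lemma cnt_rcons s v a : (0 < size s)%N -> (cnt s v <= cnt s (rcons v a) <= (cnt s v).+1)%N.
Proof.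
move=> s0; elim: v => [|d v IH].
  by rewrite [rcons _ _]/= cnt_cons addn0; case: (prefix s [:: a]).
rewrite rcons_cons !cnt_cons.
have mono : prefix s (d :: v) -> prefix s (d :: rcons v a).
  by move=> p; rewrite -rcons_cons -cats1; apply: prefix_catl.
case: (boolP (prefix s (d :: rcons v a))) mono => [p|_] mono; last first.
  by case: (prefix s (d :: v)) mono => [/(_ isT)//|_]; lia.
case: (boolP (prefix s (d :: v))) => [_|np]; first by lia.
suff E : cnt s (rcons v a) = 0%N by move: IH; rewrite E; lia.
apply: cnt_small; rewrite size_rcons ltnNge; apply: contra np => sz.
by move: p; rewrite -rcons_cons -cats1 prefix_cat_size.
Qed.

Lemma cnt_cat_r s v u : (0 < size s)%N -> (cnt s v <= cnt s (v ++ u) <= cnt s v + size u)%N.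
Proof.
move=> s0; elim/last_ind: u => [|u a IH]; first by rewrite cats0 addn0 leqnn.
rewrite -rcons_cat size_rcons; have := cnt_rcons (v ++ u) a s0; lia.
Qed.

Section Counting.
Context {R : realType}.
Variables (s : seq nat).
Hypothesis s_gt0 : (0 < size s)%N.
Hypothesis s_pos : poss s.

Lemma dev_cat_dist_r v u : `|dev s (v ++ u) - dev s v| <= (size u)%:R :> R.
Proof.
have g0 := gauss_cyl_ge0 (R := R) s_pos; have g1 := gauss_cyl_le1 (R := R) s_pos.
have /andP[c1 c2] := cnt_cat_r v u s_gt0.
have C1 : (cnt s v)%:R <= (cnt s (v ++ u))%:R :> R by rewrite ler_nat.
have C2 : (cnt s (v ++ u))%:R <= (cnt s v)%:R + (size u)%:R :> R by rewrite -natrD ler_nat.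
have U0 : 0 <= (size u)%:R :> R by [].
rewrite /dev size_cat natrD mulrDr ler_norml.
have : 0 <= (gauss_cyl s : R) * (size u)%:R <= (size u)%:R.
  by apply/andP; split; [apply: mulr_ge0 | apply: ler_piMl].
by move=> /andP[? ?]; apply/andP; split; lra.
Qed.

(** Each word satisfies [1 <= 2 den(w)^2 P(w)]. Under the expectation, the words of [B] that are
    prefixes of one random word contribute at most [2 * 2 m^2] by [sum_den_prefix], and nothing if
    there are none. The bound on [m] keeps their digits inside the alphabet. *)
Lemma count_via_prefix D K m (B : seq (seq nat)) : uniq B ->
  (forall w, w \in B -> [/\ poss w, (den w <= m)%N & (size w <= K)%N]) -> (m <= D.+1)%N ->
  (size B)%:R <= 4 * m%:R ^+ 2 *
    Ex (capp D.+1) D.+1 K 0 (fun u => (has (fun w => prefix w u) B)%:R) :> R.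
Proof.
move=> uB HB mD.
apply: (@le_trans _ _ (\sum_(w <- B) 2 * (den w)%:R ^+ 2 * wt (capp D.+1) 0 w)).
  have -> : (size B)%:R = \sum_(w <- B) 1 :> R.
    by rewrite big_const_seq count_predT iter_addr_0.
  rewrite big_seq [leRHS]big_seq ler_sum // => w /HB[w0 _ _].
  have d0 : 0 < 2 * (den w)%:R ^+ 2 :> R by rewrite mulr_gt0 // exprn_gt0 // ltr0n den_gt0.
  rewrite mulrC -ler_pdivrMr // mul1r; apply: le_trans (wt_digp_den R w0) _.
  exact: wt_digp_le_capp.
apply: (@le_trans _ _ (\sum_(w <- B) Ex (capp D.+1) D.+1 K 0
    (fun u => 2 * (den w)%:R ^+ 2 * (prefix w u)%:R))).
  rewrite big_seq [leRHS]big_seq ler_sum // => w /HB[w0 wm wK].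
  rewrite ExZ Ex_prefix // in_words eqxx /=; apply/allP => d dw.
  by rewrite (allP w0) //= (leq_trans _ mD) // (leq_trans _ wm) // digit_le_den.
rewrite -Ex_sum -ExZ; apply: le_Ex => // u /words_pos u0.
have [hasB|/hasPn noB] := boolP (has _ B); last first.
  by rewrite mulr0 big_seq big1 // => w /noB /negbTE ->; rewrite mulr0.
have := sum_den_prefix uB u0 (fun w wB => let: And3 _ h _ := HB w wB in h).
rewrite -(ler_nat R) natrM natrX natr_sum big_mkcond /= => H.
rewrite mulr1 (_ : 4 * m%:R ^+ 2 = 2 * (2 * m%:R ^+ 2)); last by ring.
apply: le_trans (ler_wpM2l _ H) => //; rewrite big_distrr; apply: ler_sum => w _ /=.
by case: (prefix w u); rewrite ?mulr0 ?mulr1 // natrX.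
Qed.

(** A bad word is cut down to the longest prefix whose length is a multiple of [h]. Fewer than [h]
    letters are lost, at most [eps/2] of the length, so the prefix still deviates by more than
    [eps/2] of its length. Chebyshev at each of the [I] grid lengths and a union bound finish. *)
Lemma long_bad_count (eps : R) M h I K m (B : seq (seq nat)) :
  0 < eps -> 2 <= M%:R * eps -> (0 < h)%N -> (0 < M)%N -> (K < I.+1 * h)%N ->
  uniq B ->
  (forall w, w \in B -> [/\ poss w, (den w <= m)%N, (M * h <= size w <= K)%N &
     eps * (size w)%:R < `|dev s w|]) ->
  (size B)%:R <= 4 * m%:R ^+ 2 * (I%:R * (4 * (4 * (size s)%:R + 345) / (eps ^+ 2 * h%:R))).
Proof.
move=> e0 eM h0 M0 KI uB HB.
(* The three summands make the cap exceed the digits of the words in [B] and those of [s], and give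
   [2 k^2 <= D] for each grid length [k <= K]. *)
pose D := (m + sumn s + 2 * K ^ 2)%N.
apply: le_trans (@count_via_prefix D.+2 K m B uB _ _) _.
- by move=> w /HB[w0 wm /andP[_ wK] _]; split.
- by rewrite /D; lia.
apply: ler_wpM2l; first by rewrite mulr_ge0 // exprn_ge0.
have s_lt : all (fun d => d < D.+3)%N s.
  apply/allP => d ds; have : (d <= sumn s)%N.
    elim: s ds => //= a r IH; rewrite in_cons => /orP[/eqP ->|/IH]; lia.
  by rewrite /D; lia.
pose G i (v : seq nat) : R := (eps / 2 * (i * h)%N%:R < `|dev s v| :> R)%R%:R.
apply: (@le_trans _ _ (\sum_(i <- iota 1 I | (i * h <= K)%N)
    Ex (capp D.+3) D.+3 K 0 (fun u => G i (take (i * h) u)))).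
  rewrite -Ex_sum; apply: le_Ex => // u; rewrite in_words => /andP[/eqP uK _].
  have [/hasP[w wB pw]|_] := boolP (has _ B); last first.
    by rewrite sumr_ge0 // => i _; rewrite /G; case: (_ < _).
  have [w0 wm /andP[hw wK] dw] := HB w wB.
  pose i := (size w %/ h)%N.
  have iM : (M <= i)%N by rewrite /i leq_divRL.
  have ih : (i * h <= size w)%N by rewrite leq_trunc_div.
  have ih' : (size w < i * h + h)%N by rewrite /i -mulSnr -ltn_divLR.
  have iI : (i \in iota 1 I).
    rewrite mem_iota add1n (leq_trans M0 iM).
    by rewrite -(ltn_pmul2r h0); apply: leq_ltn_trans ih _; apply: leq_ltn_trans KI.
  rewrite big_mkcond (bigD1_seq i) ?iota_uniq //= ifT; last exact: leq_trans wK.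
  rewrite ler_wpDr ?sumr_ge0 // => [j _|]; first by case: ifP => // _; rewrite /G; case: (_ < _).
  rewrite /G; have -> : take (i * h) u = take (i * h) w.
    by move: pw; rewrite prefixE => /eqP <-; rewrite take_takel.
  suff -> : eps / 2 * (i * h)%N%:R < `|dev s (take (i * h) w)| by [].
  have := dev_cat_dist_r (take (i * h) w) (drop (i * h) w); rewrite cat_take_drop size_drop.
  have L1 : (i * h)%N%:R <= (size w)%:R :> R by rewrite ler_nat.
  have L2 : M%:R * (size w - i * h)%N%:R <= (size w)%:R :> R.
    rewrite -natrM ler_nat; apply: leq_trans hw.
    by rewrite leq_mul2l leq_subLR (ltnW ih') orbT.
  have L3 : (size w - i * h)%N%:R <= eps / 2 * (size w)%:R :> R.
    have M0' : 0 < M%:R :> R by rewrite ltr0n.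
    rewrite -(ler_pM2l M0'); apply: le_trans L2 _.
    have := ler_wpM2r (ler0n R (size w)) eM; lra.
  have L4 : eps / 2 * (i * h)%N%:R <= eps / 2 * (size w)%:R by rewrite ler_pM2l // divr_gt0.
  move=> L5; have := lerB_dist (dev s w : R) (dev s (take (i * h) w)); lra.
apply: (@le_trans _ _ (\sum_(i <- iota 1 I)
    (4 * (4 * (size s)%:R + 345) / (eps ^+ 2 * h%:R)))); last first.
  by rewrite big_const_seq count_predT size_iota iter_addr_0 [leRHS]mulr_natl.
rewrite big_mkcond big_seq [leRHS]big_seq; apply: ler_sum => i; rewrite mem_iota => /andP[i0 _].
have h0' : 0 < h%:R :> R by rewrite ltr0n.
have i1 : 1 <= i%:R :> R by rewrite ler1n.
set C := 4 * (size s)%:R + 345.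
have C0 : 0 <= C by rewrite /C; have := ler0n R (size s); lra.
have CC : 0 <= 4 * C / (eps ^+ 2 * h%:R).
  by apply: divr_ge0; apply: mulr_ge0 => //; rewrite ?exprn_ge0 ?ltW.
case: ifP => // ihK.
rewrite Ex_take //.
have ih1 : 0 < (i * h)%N%:R :> R by rewrite ltr0n muln_gt0 i0.
apply: le_trans (@Chebyshev_dev R s D s_gt0 s_pos s_lt (i * h) 0 _ _ _ _) _.
- by rewrite /D; apply: leq_trans (leq_addl _ _); rewrite leq_mul2l leq_exp2r.
- by rewrite /in01 lexx ler01.
- by rewrite mulr_gt0 // divr_gt0.
rewrite natrM -/C.
have -> : i%:R * h%:R * C / (eps / 2 * (i%:R * h%:R)) ^+ 2 = 4 * C / (eps ^+ 2 * h%:R) / i%:R.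
  by field; do 2!(apply/andP; split; first by lra); lra.
by rewrite ler_pdivrMr; [rewrite ler_peMr | lra].
Qed.

(** The product of the [a^(-3/2)] over the digits [a], with the power written through a square
    root. *)
Definition rankin (w : seq nat) : R := \prod_(a <- w) (a%:R * Num.sqrt a%:R)^-1.

(** A continuant is at least the product of its digits, by [den_consW] at each digit. *)
Lemma rankin_den w : poss w ->
  ((den w)%:R * Num.sqrt (den w)%:R)^-1 <= rankin w.
Proof.
rewrite /rankin; elim: w => [|a w IH] /=; first by rewrite big_nil sqrtr1 mulr1 invr1.
move=> /andP[a0 w0]; rewrite big_cons; apply: le_trans (ler_wpM2l _ (IH w0)); last first.
  by rewrite invr_ge0 mulr_ge0 ?sqrtr_ge0.
have d0 := den_gt0 w0.
have pos n : (0 < n)%N -> 0 < n%:R * Num.sqrt n%:R :> R.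
  by move=> n0; rewrite mulr_gt0 ?sqrtr_gt0 ?ltr0n.
have da : (0 < den (a :: w))%N.
  by apply: leq_trans (den_consW a w); rewrite muln_gt0 a0.
rewrite -invfM lef_pV2 ?posrE; [|exact: pos|exact: mulr_gt0 (pos _ a0) (pos _ d0)].
have := den_consW a w; rewrite -(ler_nat R) natrM => dw.
by rewrite mulrACA -sqrtrM // ler_pM ?mulr_ge0 ?sqrtr_ge0 // ler_wsqrtr.
Qed.

Lemma sum_rankin1 D : \sum_(a <- iota 1 D) (a%:R * Num.sqrt a%:R)^-1 <= 3 :> R.
Proof.
(* The correction is the integral of [x^(-3/2)] from [D+1] to infinity; it makes the induction
   close. *)
suff H : \sum_(a <- iota 1 D.+1) (a%:R * Num.sqrt a%:R)^-1 <= 3 - 2 / Num.sqrt D.+1%:R :> R.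
  apply: le_trans (le_trans H _); last by rewrite gerBl divr_ge0 ?sqrtr_ge0.
  by rewrite big_iotaS lerDl invr_ge0 mulr_ge0 ?sqrtr_ge0.
elim: D => [|D IH]; first by rewrite big_seq1 sqrtr1; lra.
rewrite big_iotaS.
have x0 : 0 < Num.sqrt D.+1%:R :> R by rewrite sqrtr_gt0 ltr0n.
have y0 : 0 < Num.sqrt D.+2%:R :> R by rewrite sqrtr_gt0 ltr0n.
have xx : Num.sqrt D.+1%:R ^+ 2 = D.+1%:R :> R by rewrite sqr_sqrtr.
have yy : Num.sqrt D.+2%:R ^+ 2 = D.+2%:R :> R by rewrite sqr_sqrtr.
have yx : Num.sqrt D.+2%:R ^+ 2 = Num.sqrt D.+1%:R ^+ 2 + 1 :> R by rewrite xx yy -natr1.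
rewrite -[D.+2%:R * _]/(D.+2%:R * Num.sqrt D.+2%:R) -[X in (X * _)^-1]yy.
move: (Num.sqrt D.+1%:R) (Num.sqrt D.+2%:R) x0 y0 yx IH {xx yy} => x y x0 y0 yx IH.
suff : (y ^+ 2 * y)^-1 <= 2 / x - 2 / y by lra.
have -> : 2 / x - 2 / y = 2 * (y - x) / (x * y) by field; apply/andP; split; lra.
have -> : 2 * (y - x) / (x * y) = 2 / (x * y * (x + y)) * (y ^+ 2 - x ^+ 2).
  by field; do 2?(apply/andP; split); lra.
have -> : y ^+ 2 - x ^+ 2 = 1 by rewrite yx; ring.
have xy : x <= y by nra.
rewrite mulr1 -[leLHS]mul1r ler_pdivrMr; last by rewrite !mulr_gt0 // exprn_gt0.
rewrite mulrAC ler_pdivlMr ?mulr_gt0 ?addr_gt0 // mul1r.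
have : x * y <= y * y by rewrite ler_pM2r.
nra.
Qed.

Lemma sum_rankin D k : \sum_(w <- words D k) rankin w <= 3 ^+ k.
Proof.
elim: k => [|k IH]; first by rewrite /= big_seq1 /rankin big_nil.
have -> : \sum_(w <- words D k.+1) rankin w =
   (\sum_(a <- iota 1 D) (a%:R * Num.sqrt a%:R)^-1) * \sum_(w <- words D k) rankin w.
  rewrite /= big_allpairs_dep big_distrl /=; apply: eq_bigr => a _.
  by rewrite big_distrr; apply: eq_bigr => w _; rewrite /rankin big_cons.
rewrite exprS ler_pM ?sum_rankin1 //; apply: sumr_ge0 => a _.
  by rewrite invr_ge0 mulr_ge0 ?sqrtr_ge0.
by apply: prodr_ge0 => i _; rewrite invr_ge0 mulr_ge0 ?sqrtr_ge0.
Qed.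

(** Each word satisfies [1 <= m^(3/2) rankin(w)], and the weights of all words of length [k] sum to
    at most [3^k]. *)
Lemma short_count k0 m (B : seq (seq nat)) : uniq B ->
  (forall w, w \in B -> [/\ poss w, (den w <= m)%N & (size w < k0)%N]) ->
  (size B)%:R <= m%:R * Num.sqrt m%:R * 3 ^+ k0 :> R.
Proof.
move=> uB HB.
have pos n : 0 <= n%:R * Num.sqrt n%:R :> R by rewrite mulr_ge0 ?sqrtr_ge0.
have rk0 w : 0 <= rankin w.
  by apply: prodr_ge0 => i _; rewrite invr_ge0 pos.
apply: (@le_trans _ _ (\sum_(w <- B) (m%:R * Num.sqrt m%:R * rankin w))).
  have -> : (size B)%:R = \sum_(w <- B) 1 :> R.
    by rewrite big_const_seq count_predT iter_addr_0.
  rewrite big_seq [leRHS]big_seq ler_sum // => w /HB[w0 wm _].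
  apply: le_trans (ler_wpM2l (pos m) (rankin_den w0)).
  have d0 := den_gt0 w0.
  rewrite ler_pdivlMr ?mulr_gt0 ?sqrtr_gt0 ?ltr0n // mul1r ler_pM ?sqrtr_ge0 ?ler_nat //.
  by rewrite ler_wsqrtr ?ler_nat.
rewrite -big_distrr /= ler_wpM2l //.
apply: (@le_trans _ _ (\sum_(w <- flatten [seq words m k | k <- iota 0 k0]) rankin w)).
  apply: ler_sum_sub => // w wB; have [w0 wm wk] := HB w wB.
  apply/flattenP; exists (words m (size w)); first by apply: map_f; rewrite mem_iota.
  rewrite in_words eqxx /=; apply/allP => d dw.
  by rewrite (allP w0) //= (leq_trans _ wm) // digit_le_den.
rewrite big_flatten big_map.
apply: (@le_trans _ _ (\sum_(k <- iota 0 k0) 3 ^+ k)).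
  by apply: ler_sum => k _; apply: sum_rankin.
elim: k0 {HB} => [|k IH]; first by rewrite big_nil.
rewrite -{1}(addn1 k) iotaD big_cat big_seq1 add0n exprS /=.
have : 0 <= 3 ^+ k :> R by rewrite exprn_ge0.
lra.
Qed.

(** The words are split at length [M h], with [h] about [log m / (7M)]: longer ones fall under
    [long_bad_count], where [1/h] supplies the logarithmic gain, and shorter ones under
    [short_count]. *)
Lemma bad_words_count (eps : R) : 0 < eps ->
  exists C : R, exists m0 : nat, forall m (B : seq (seq nat)), (m0 <= m)%N -> uniq B ->
    (forall w, w \in B -> [/\ poss w, (den w <= m)%N & eps * (size w)%:R < `|dev s w|]) ->
    (size B)%:R <= C * (m%:R ^+ 2 / (trunc_log 2 m)%:R).
Proof.
move=> e0.
have [M M0 eM] : exists2 M : nat, (0 < M)%N & 2 <= M%:R * eps.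
  exists (Num.truncn (2 / eps)).+1 => //.
  rewrite -ler_pdivrMr // ltW //; exact: truncnS_gt.
pose I := (60 * M)%N.
pose C1 : R := 4 * (I%:R * (4 * (4 * (size s)%:R + 345) / eps ^+ 2)) * (14 * M)%N%:R.
exists (C1 + 14), (2 ^ (7 * M))%N => m B mM uB HB.
set la := trunc_log 2 m; pose h := (la %/ (7 * M))%N.
have m0 : (0 < m)%N by apply: leq_trans mM; rewrite expn_gt0.
have laM : (7 * M <= la)%N by apply: trunc_log_max.
have h0 : (0 < h)%N by rewrite divn_gt0 // muln_gt0.
have hle : (7 * M * h <= la)%N by rewrite mulnC leq_trunc_div.
have hlt : (la <= 14 * M * h)%N.
  have a1 : (la < h.+1 * (7 * M))%N by rewrite -ltn_divLR // muln_gt0.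
  have a2 := leq_pmull (7 * M) h0.
  have -> : (14 * M * h = h * (7 * M) + h * (7 * M))%N by ring.
  by move: a1; rewrite mulSn; lia.
have la0 : 0 < la%:R :> R by rewrite ltr0n (leq_trans _ laM) // muln_gt0.
have lam : (2 ^ la <= m)%N by apply: trunc_logP.
pose Bl := [seq w <- B | (M * h <= size w)%N].
pose Bs := [seq w <- B | ~~ (M * h <= size w)%N].
have -> : size B = (size Bl + size Bs)%N by rewrite !size_filter count_predC.
have HR : 0 < m%:R :> R by rewrite ltr0n.
rewrite natrD mulrDl lerD //.
(* By [den_pow] a continuant at most [m] forces length at most [2 la + 1]. Since [la <= 14 M h], the
   [60 M] grid points reach that far. *)
- pose K := (2 * la + 1)%N.
  apply: le_trans (@long_bad_count eps M h I K m Bl e0 eM h0 M0 _ _ _) _.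
  + rewrite /K /I mulSn; move: hlt h0; rewrite mulnAC -mulnA => hlt h0; nia.
  + exact: filter_uniq.
  + move=> w; rewrite mem_filter => /andP[hw /HB[w0 wm dw]]; split => //; rewrite hw /K /=.
    have := leq_trans (den_pow w0) wm.
    have := trunc_log_ltn m (isT : 1 < 2)%N => lt1 /leq_ltn_trans /(_ lt1).
    by rewrite ltn_exp2l // -/la ltnS leq_half_double addn1 mul2n.
  set C2 := 4 * (4 * (size s)%:R + 345) / eps ^+ 2 in C1 *.
  have K0 : 0 <= 4 * (size s)%:R + 345 :> R by have := ler0n R (size s); lra.
  have C20 : 0 <= C2.
    by apply: divr_ge0; [apply: mulr_ge0|rewrite exprn_ge0 // ltW].
  have hR : 0 < h%:R :> R by rewrite ltr0n.
  have -> : 4 * (4 * (size s)%:R + 345) / (eps ^+ 2 * h%:R) = C2 / h%:R.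
    by rewrite /C2; field; apply/andP; split; lra.
  have -> : 4 * m%:R ^+ 2 * (I%:R * (C2 / h%:R)) = m%:R ^+ 2 * (4 * (I%:R * C2)) * h%:R^-1 by ring.
  have -> : C1 * (m%:R ^+ 2 / la%:R) = m%:R ^+ 2 * (4 * (I%:R * C2)) * ((14 * M)%N%:R / la%:R).
    by rewrite /C1; ring.
  apply: ler_wpM2l.
    by apply: mulr_ge0; [rewrite exprn_ge0|apply: mulr_ge0 => //; apply: mulr_ge0].
  by rewrite -[leLHS]mul1r ler_pdivrMr // mulrAC ler_pdivlMr // mul1r -natrM ler_nat.
- apply: le_trans (@short_count (M * h) m Bs _ _) _.
  + exact: filter_uniq.
  + by move=> w; rewrite mem_filter -ltnNge => /andP[hw /HB[]].
  have -> : 14 * (m%:R ^+ 2 / la%:R) = m%:R * (14 * m%:R / la%:R) :> R by ring.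
  rewrite -mulrA ler_pM2l // ler_pdivlMr //.
  (* The factor 7 in [h] is used here: [9^2 <= 2^7] and [2^(7 M h) <= m]. The 9 is needed because
     one factor [3^(M h)] counts words and a second one absorbs [la]. *)
  have S : (9 : R) ^+ (M * h) <= Num.sqrt m%:R.
    rewrite -(ler_pXn2r (n := 2)) ?nnegrE ?exprn_ge0 ?sqrtr_ge0 // sqr_sqrtr //.
    rewrite -exprM mulnC exprM -natrX -natrX ler_nat.
    apply: leq_trans (_ : (2 ^ 7) ^ (M * h) <= _)%N; first by rewrite leq_exp2r // muln_gt0 M0.
    by rewrite -expnM; apply: leq_trans lam; rewrite leq_exp2l // mulnA.
  have T : la%:R <= 14 * 3 ^+ (M * h) :> R.
    rewrite -natrX -natrM ler_nat; apply: leq_trans hlt _.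
    by rewrite -mulnA leq_mul2l /= ltnW // ltn_expl.
  have -> : 14 * m%:R = Num.sqrt m%:R * (14 * Num.sqrt m%:R) :> R.
    by rewrite mulrCA -expr2 sqr_sqrtr.
  rewrite -mulrA ler_wpM2l ?sqrtr_ge0 //.
  apply: le_trans (_ : 3 ^+ (M * h) * (14 * 3 ^+ (M * h)) <= _).
    by rewrite ler_wpM2l ?exprn_ge0.
  rewrite mulrCA -exprMn ler_pM2l // (_ : 3 * 3 = 9 :> R) //; ring.
Qed.

End Counting.

(** * Enumeration of the rationals *)

Lemma numden_cat v x y : numden x = numden y -> numden (v ++ x) = numden (v ++ y).
Proof. by move=> xy; elim: v => //= a v ->. Qed.

Lemma cf_greedy_spec fuel p q : (p < q)%N -> (p < fuel)%N -> coprime p q ->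
  poss (cf_greedy fuel p q) /\ numden (cf_greedy fuel p q) = (p, q).
Proof.
elim: fuel p q => // fuel IH p q pq pf cpq /=; case: eqVneq => [p0|p0] /=.
  by move: cpq; rewrite p0 /coprime gcd0n => /eqP ->.
have pp : (0 < p)%N by lia.
have rp : (q %% p < p)%N by rewrite ltn_mod.
have [|||h1 h2] := IH (q %% p)%N p; [by []|by lia|by rewrite coprime_modl coprime_sym|].
by rewrite h1 h2 divn_gt0 // ltnW //= -divn_eq.
Qed.

(** Replacing a last digit [l > 1] by [l - 1, 1] keeps the digits positive and the value of the
    tail, hence [numden] of the whole word by [numden_cat]. *)
Lemma cf_rat_spec p q : (0 < p < q)%N -> coprime p q ->
  [/\ poss (cf_rat (p, q)), numden (cf_rat (p, q)) = (p, q) & (0 < size (cf_rat (p, q)))%N].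
Proof.
move=> /andP[p0 pq] cpq; rewrite /cf_rat.
have [h1 h2] := @cf_greedy_spec q.+1 p q pq (leqW pq) cpq.
case: (cf_greedy _ _ _) h1 h2 => [_ [/eqP]|a s' h1 h2].
  by rewrite eq_sym (negbTE (lt0n_neq0 p0)).
case: ifP => [l1|_]; last by split.
move: h1 h2; rewrite lastI; move: (belast a s') (last a s') l1 => v l l1.
rewrite /poss !all_rcons => /andP[_ v0]; rewrite -!cats1 => h2; split.
- by rewrite v0 /= -subn1 subn_gt0 l1.
- rewrite -h2 -catA; apply: numden_cat => /=.
  by rewrite !muln1 !addn0 addn1 prednK // ltnW.
- by rewrite !size_cat addn1.
Qed.

Lemma mem_rat_list Q p q :
  ((p, q) \in rat_list Q) = [&& (1 < q <= Q.+1)%N, (0 < p < q)%N & coprime p q].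
Proof.
apply/flatten_mapP/idP => [[q']|].
  rewrite mem_iota => hq /mapP[p']; rewrite mem_filter mem_iota => hp [-> ->].
  by move: hp => /andP[-> hp]; apply/and3P; split=> //; lia.
move=> /and3P[hq hp cp]; exists q; first by rewrite mem_iota; lia.
by apply/mapP; exists p => //; rewrite mem_filter cp mem_iota; lia.
Qed.

Lemma rat_listS Q :
  rat_list Q.+1 = rat_list Q ++ [seq (p, Q.+2) | p <- iota 1 Q.+1 & coprime p Q.+2].
Proof.
by rewrite /rat_list -{1}(addn1 Q) iotaD map_cat flatten_cat /= cats0.
Qed.

Lemma rat_list_prefix Q Q' : (Q <= Q')%N -> exists r, rat_list Q' = rat_list Q ++ r.
Proof.
move=> /subnKC <-; elim: (Q' - Q)%N => [|n [r IH]]; first by exists [::]; rewrite addn0 cats0.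
by rewrite addnS rat_listS IH -catA; eexists.
Qed.

Lemma rat_list_uniq Q : uniq (rat_list Q).
Proof.
elim: Q => // Q IH; rewrite rat_listS cat_uniq IH; apply/and3P; split => //.
  apply/hasPn => -[p q] /mapP[p' _ [-> ->]].
  by apply/negP; rewrite mem_rat_list => /andP[]; lia.
by rewrite map_inj_uniq ?filter_uniq ?iota_uniq // => a b [].
Qed.

Lemma size_rat_list_ge Q : (Q <= size (rat_list Q))%N.
Proof.
elim: Q => // Q IH; rewrite rat_listS size_cat size_map -addn1 leq_add //.
rewrite lt0n size_eq0 -has_filter; apply/hasP; exists 1%N; first by rewrite mem_iota; lia.
by rewrite /= coprime1n.
Qed.

Lemma rseqE Q i : (0 < i <= size (rat_list Q))%N -> rseq i = nth (0, 1)%N (rat_list Q) i.-1.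
Proof.
move=> /andP[i0 iQ]; rewrite /rseq; have ii := size_rat_list_ge i.
have [iQ'|/ltnW iQ'] := leqP i Q; have [r E] := rat_list_prefix iQ'.
  by rewrite E nth_cat ifT //; lia.
by rewrite E nth_cat ifT //; lia.
Qed.

Lemma rseq_spec i : (0 < i)%N ->
  [/\ (0 < (rseq i).1 < (rseq i).2)%N & coprime (rseq i).1 (rseq i).2].
Proof.
move=> i0; have ii := size_rat_list_ge i.
have : rseq i \in rat_list i by apply: mem_nth; rewrite prednK.
by case: (rseq i) => p q; rewrite mem_rat_list => /and3P[_ -> ->].
Qed.

Lemma Lcf_gt0 i : (0 < i)%N -> (0 < Lcf (rseq i))%N.
Proof.
by move=> /rseq_spec; case: (rseq i) => p q /= [h1 h2]; have [] := cf_rat_spec h1 h2.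
Qed.

Lemma poss_cf_rat i : (0 < i)%N -> poss (cf_rat (rseq i)).
Proof.
by move=> /rseq_spec; case: (rseq i) => p q /= [h1 h2]; have [] := cf_rat_spec h1 h2.
Qed.

Lemma numden_cf_rat i : (0 < i)%N -> numden (cf_rat (rseq i)) = rseq i.
Proof.
by move=> /rseq_spec; case: (rseq i) => p q /= [h1 h2]; have [] := cf_rat_spec h1 h2.
Qed.

(** * Quadratic growth of the number of reduced fractions *)

Definition pairs n : seq (nat * nat) := [seq (p, q) | q <- iota 1 n, p <- iota 1 q.-1].

Lemma mem_pairs n p q : ((p, q) \in pairs n) = (0 < p < q)%N && (q <= n)%N.
Proof.
apply/allpairsPdep/idP => [[q' [p' []]]|/andP[hp hq]].
  by rewrite !mem_iota => h1 h2 [-> ->]; lia.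
by exists q, p; rewrite !mem_iota; split=> //; lia.
Qed.

Lemma pairs_uniq n : uniq (pairs n).
Proof.
apply: allpairs_uniq_dep => [|q _|]; try exact: iota_uniq.
by move=> [q p] [q' p'] _ _ /= [-> ->].
Qed.

Lemma size_pairs n : (2 * size (pairs n) = n * n.-1)%N.
Proof.
rewrite size_allpairs_dep; elim: n => // n IH.
rewrite -{1}(addn1 n) iotaD map_cat sumn_cat mulnDr IH /= size_iota.
by case: n {IH} => // n; nia.
Qed.

(* A non-coprime pair is d times a pair, for some d >= 2. *)
Lemma size_noncoprime n :
  (size [seq x <- pairs n | ~~ coprime x.1 x.2] <= \sum_(d <- iota 2 n) size (pairs (n %/ d)))%N.
Proof.
pose r := flatten [seq [seq (d * x.1, d * x.2)%N | x <- pairs (n %/ d)] | d <- iota 2 n].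
have -> : (\sum_(d <- iota 2 n) size (pairs (n %/ d)) = size r)%N.
  rewrite size_flatten /shape sumnE !big_map; apply: eq_bigr => d _.
  by rewrite size_map.
apply: uniq_leq_size; first by rewrite filter_uniq ?pairs_uniq.
move=> [p q]; rewrite mem_filter mem_pairs /= => /and3P[cpq hp hq].
have g0 : (0 < gcdn p q)%N by rewrite gcdn_gt0; lia.
have g2 : (1 < gcdn p q)%N by move: cpq; rewrite /coprime; lia.
apply/flatten_mapP; exists (gcdn p q).
  rewrite mem_iota g2 /=; have := @dvdn_leq (gcdn p q) q _ (dvdn_gcdr _ _); lia.
have ep : (gcdn p q * (p %/ gcdn p q) = p)%N by rewrite mulnC divnK ?dvdn_gcdl.
have eq : (gcdn p q * (q %/ gcdn p q) = q)%N by rewrite mulnC divnK ?dvdn_gcdr.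
apply/mapP; exists (p %/ gcdn p q, q %/ gcdn p q)%N; last by rewrite /= ep eq.
rewrite mem_pairs leq_div2r // andbT; apply/andP; split; first by nia.
by rewrite -(ltn_pmul2l g0) ep eq; case/andP: hp.
Qed.

(** The term [d = 2] gives 1/4; from [d = 3] on, [1/d^2 <= 1/(d-1) - 1/d] telescopes to at most
    1/2. *)
Lemma sum_inv_sq (R : realFieldType) n : (\sum_(d <- iota 2 n) (d%:R ^+ 2)^-1 <= 3 / 4 :> R).
Proof.
suff H k : \sum_(d <- iota 2 k.+1) (d%:R ^+ 2)^-1 <= 3 / 4 - k.+2%:R^-1 :> R.
  have := H n; rewrite -{1}(addn1 n) iotaD big_cat big_seq1 /= => Hn.
  have h1 : 0 <= ((2 + n)%:R ^+ 2)^-1 :> R by rewrite invr_ge0 exprn_ge0.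
  have h2 : 0 <= n.+2%:R^-1 :> R by rewrite invr_ge0.
  apply: le_trans (le_trans Hn _); last by rewrite gerBl.
  by rewrite lerDl.
elim: k => [|k IH]; first by rewrite big_seq1; lra.
rewrite -{1}(addn1 k.+1) iotaD big_cat big_seq1 /=.
apply: le_trans (lerD IH (lexx _)) _.
have K0 : 0 <= k%:R :> R by [].
have E3 : k.+3%:R = k%:R + 3 :> R by rewrite -(addn3 k) natrD.
have E2 : k.+2%:R = k%:R + 2 :> R by rewrite -(addn2 k) natrD.
rewrite !add2n !E3 !E2.
suff : ((k%:R + 3) ^+ 2)^-1 <= (k%:R + 2)^-1 - (k%:R + 3)^-1 :> R by lra.
have -> : (k%:R + 2)^-1 - (k%:R + 3)^-1 = ((k%:R + 2) * (k%:R + 3))^-1 :> R.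
  by field; apply/andP; split; lra.
by rewrite lef_pV2 ?posrE; nra.
Qed.

(** Of the [n(n-1)/2] pairs at most [3 n^2/8] are not coprime, as the multiples of [d] number at
    most [(n/d)^2/2]. The rest, [n^2/8 - n/2], is at least [n^2/16] once [n >= 8]. *)
Lemma size_rat_list_quadratic n : (8 <= n)%N -> (n ^ 2 <= 16 * size (rat_list n.-1))%N.
Proof.
move=> n8.
have E : (size (pairs n) <= size (rat_list n.-1) +
    size [seq x <- pairs n | ~~ coprime x.1 x.2])%N.
  rewrite -(count_predC (fun x => coprime x.1 x.2)) -!size_filter leq_add2r.
  apply: uniq_leq_size; first by rewrite filter_uniq ?pairs_uniq.
  move=> [p q]; rewrite mem_filter mem_pairs mem_rat_list /= => /and3P[-> hp hq].
  by rewrite hp andbT /= andbT; lia.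
have := leq_trans E (leq_add (leqnn _) (size_noncoprime n)).
have S : (\sum_(d <- iota 2 n) size (pairs (n %/ d)))%N%:R <= 3 / 8 * n%:R ^+ 2 :> rat.
  apply: (@le_trans _ _ (\sum_(d <- iota 2 n) n%:R ^+ 2 / 2 * (d%:R ^+ 2)^-1)).
    rewrite natr_sum big_seq [leRHS]big_seq ler_sum // => d; rewrite mem_iota => /andP[d2 _].
    have d0 : 0 < d%:R :> rat by rewrite ltr0n; lia.
    have h1 : (n %/ d)%:R * d%:R <= n%:R :> rat by rewrite -natrM ler_nat leq_trunc_div.
    have h2 : 2 * (size (pairs (n %/ d)))%:R <= (n %/ d)%:R ^+ 2 :> rat.
      by rewrite -natrX -natrM ler_nat size_pairs -mulnn leq_mul2l leq_pred orbT.
    rewrite ler_pdivlMr ?exprn_gt0 //.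
    have h3 : ((n %/ d)%:R * d%:R) ^+ 2 <= n%:R ^+ 2 :> rat.
      by rewrite ler_pXn2r ?nnegrE ?mulr_ge0.
    have := ler_wpM2r (ltW (exprn_gt0 2 d0)) h2; rewrite exprMn in h3; lra.
  rewrite -big_distrr /=; have := sum_inv_sq rat n => H.
  have := ler_wpM2l (exprn_ge0 2 (ler0n rat n)) H; lra.
move=> T; rewrite -(ler_nat rat) natrX natrM.
have {}T := leq_mul (leqnn 2) T; rewrite size_pairs in T.
move: T; rewrite -(ler_nat rat) !natrM natrD => T.
have n8' : 8 <= n%:R :> rat by rewrite ler_nat.
have nE : n.-1%:R = n%:R - 1 :> rat by rewrite -subn1 natrB //; lia.
rewrite nE in T; nra.
Qed.

Lemma rseq_inj Q i j : (0 < i <= size (rat_list Q))%N -> (0 < j <= size (rat_list Q))%N ->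
  rseq i = rseq j -> i = j.
Proof.
move=> hi hj; rewrite (rseqE hi) (rseqE hj) => /eqP.
case/andP: hi => i0 iQ; case/andP: hj => j0 jQ.
by rewrite nth_uniq ?rat_list_uniq ?prednK // => /eqP /(congr1 succn); rewrite !prednK.
Qed.

Lemma size_rat_list_le Q : (size (rat_list Q) <= Q.+1 ^ 2)%N.
Proof.
apply: leq_trans (_ : size (pairs Q.+1) <= _)%N.
  apply: uniq_leq_size; first exact: rat_list_uniq.
  by move=> [p q]; rewrite mem_rat_list mem_pairs => /and3P[/andP[_ ->] -> _].
have := size_pairs Q.+1; rewrite -mulnn /=; nia.
Qed.

(** For the least [Q] with [N <= size (rat_list Q)], the first [N] fractions have denominators at
    most [Q + 1]. Quadratic growth gives [(Q+1)^2 <= 64 N], and [ln N] is at most 4 times the binary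
    logarithm of [Q + 1]; hence the factor 256. *)
Lemma bad_rat_density (R : realType) s (eps : R) : (0 < size s)%N -> poss s -> 0 < eps ->
  exists C : R, exists M : nat, forall N : nat, (M <= N)%N ->
    (count_upto (fun i => eps * (Lcf (rseq i))%:R < `|dev s (cf_rat (rseq i))|) N)%:R
      <= C * N%:R / ln (N%:R : R).
Proof.
move=> s0 sp e0; have [C0 [m0 H]] := bad_words_count s0 sp e0.
(* As [N <= (Q+1)^2], the term [m0^2] forces [m0 <= Q + 1], and 100 > 8^2 forces [Q >= 8]. *)
exists (256 * `|C0|), (m0 ^ 2 + 100)%N => N MN; rewrite /count_upto; set S := (X in count X).
have N0 : (0 < N)%N by lia.
have ex : exists Q, (N <= size (rat_list Q))%N by exists N; apply: size_rat_list_ge.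
case: (ex_minnP ex) => Q NQ Qmin.
have Nm : (N <= Q.+1 ^ 2)%N := leq_trans NQ (size_rat_list_le Q).
have Q8 : (8 <= Q)%N.
  rewrite leqNgt; apply/negP => Q8; have : (Q.+1 ^ 2 <= 8 ^ 2)%N by rewrite leq_exp2r.
  by lia.
have QN : (Q ^ 2 <= 16 * N)%N.
  apply: leq_trans (size_rat_list_quadratic Q8) _; rewrite leq_mul2l /=.
  by rewrite leqNgt; apply/negP => /ltnW /Qmin; lia.
have mm : (m0 <= Q.+1)%N.
  by rewrite -(@leq_exp2r _ _ 2) //; apply: leq_trans Nm; lia.
have m64 : (Q.+1 ^ 2 <= 64 * N)%N.
  apply: leq_trans (_ : (2 * Q) ^ 2 <= _)%N; first by rewrite leq_exp2r //; lia.
  by rewrite expnMn; lia.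
pose B := [seq cf_rat (rseq i) | i <- iota 1 N & S i].
have inN i : i \in [seq i <- iota 1 N | S i] -> (0 < i <= size (rat_list Q))%N /\ S i.
  by rewrite mem_filter mem_iota => /andP[-> /andP[i0 iN]]; split => //; lia.
have uB : uniq B.
  rewrite map_inj_in_uniq ?filter_uniq ?iota_uniq // => i j /inN[hi _] /inN[hj _] E.
  apply: (rseq_inj hi hj); case/andP: hi => i0 _; case/andP: hj => j0 _.
  by rewrite -(numden_cf_rat i0) -(numden_cf_rat j0) E.
have HB w : w \in B -> [/\ poss w, (den w <= Q.+1)%N & eps * (size w)%:R < `|dev s w|].
  move=> /mapP[i /inN[hi Si] ->]; have /andP[i0 iQ] := hi; split => //; first exact: poss_cf_rat.
  rewrite /den numden_cf_rat //.
  have : rseq i \in rat_list Q by rewrite (rseqE hi) mem_nth //; case: (i) i0 iQ.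
  by case: (rseq i) => p q; rewrite mem_rat_list => /andP[/andP[_ ->]].
have := H Q.+1 B mm uB HB; rewrite size_map size_filter => cle.
set la := trunc_log 2 Q.+1 in cle.
have la1 : (1 <= la)%N by apply: trunc_log_max => //; lia.
have N1 : 1 < N%:R :> R by rewrite ltr1n; lia.
have lnN : 0 < ln (N%:R : R) by apply: ln_gt0.
have la0 : 0 < la%:R :> R by rewrite ltr0n.
have lnla : ln (N%:R : R) <= 4 * la%:R.
  apply: le_trans (_ : ln ((2 ^+ la.+1) ^+ 2) <= _).
    rewrite ler_ln ?posrE ?ltr0n ?exprn_gt0 // -!natrX ler_nat (leq_trans Nm) //.
    by rewrite leq_exp2r // ltnW // trunc_log_ltn.
  rewrite -exprM lnXn // -[leLHS]mulr_natr; have l2 : ln (2 : R) <= 1.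
    by have := @le_ln1Dx R 1; rewrite (_ : 1 + 1 = 2) //; apply; lra.
  apply: le_trans (ler_wpM2r _ l2) _ => //.
  by rewrite mul1r -natrM ler_nat; lia.
apply: le_trans cle _.
apply: le_trans (_ : `|C0| * (Q.+1%:R ^+ 2 / la%:R) <= _).
  by rewrite ler_wpM2r ?ler_norm // divr_ge0 ?exprn_ge0.
have -> : 256 * `|C0| * N%:R / ln N%:R = `|C0| * (64 * N%:R * (4 / ln N%:R)) :> R by ring.
rewrite ler_wpM2l // ler_pM ?exprn_ge0 ?invr_ge0 //.
  by rewrite -natrX -natrM ler_nat.
by rewrite ler_pdivlMr // mulrC ler_pdivrMr.
Qed.

(** * Gauss measure of a cylinder *)

Section GaussMeasure.
Context {R : realType}.
Local Notation mu := (@lebesgue_measure R).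

Lemma gauss_map_digit (y : R) d : (0 < d)%N -> 0 <= y < 1 ->
  gauss_map (d%:R + y)^-1 = y /\ Num.truncn ((d%:R + y)^-1)^-1 = d.
Proof.
move=> d0 /andP[y0 y1]; have d1 := @ler1n_digit R _ d0.
rewrite /gauss_map invr_eq0 invrK; split.
  rewrite ifF; last by apply/negbTE/lt0r_neq0; lra.
  have -> : Num.floor (d%:R + y) = d%:Z.
    by apply: floor_def; rewrite intrD -!pmulrn lerDl y0 ltrD2l.
  by rewrite -pmulrn addrC addKr.
by apply: truncn_def; rewrite -natr1 lerDl y0 ltrD2l.
Qed.

Lemma cf_digit_cons (x : R) i : cf_digit x i.+2 = cf_digit (gauss_map x) i.+1.
Proof. by rewrite /cf_digit !succnK iterSr. Qed.

(** The last condition excludes [d = 1], [y = 0], where the point is 1 and lies outside [0,1). *)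
Lemma cylinder_cons d s (y : R) : (0 < d)%N -> 0 <= y < 1 -> (d%:R + y)^-1 < 1 ->
  cylinder (d :: s) (d%:R + y)^-1 <-> cylinder s y.
Proof.
move=> d0 y01 x1; have [g t] := gauss_map_digit d0 y01; have d1 := @ler1n_digit R _ d0.
have /andP[y0 _] := y01; split=> [[_ H]|[_ H]]; split => //.
- by move=> j js; have := H j.+1 js; rewrite cf_digit_cons g.
- by rewrite x1 invr_ge0 addr_ge0.
- by case=> [|j] js; [exact: t|rewrite cf_digit_cons g; exact: H].
Qed.

(** Which endpoints belong to a cylinder varies with [s]; enclosing it between the open and the
    closed hull is enough, since endpoints are null. *)
Lemma cylinder_subset s : poss s ->
  @cylinder R s `<=` `[(hull s).1, (hull s).2].
Proof.
elim: s => [_ x [/andP[x0 x1] _]|d s IH /andP[d0 s0] x Hx] /=.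
  by rewrite in_itv /= x0 ltW.
have [/andP[x0 x1] H] := Hx; have := H 0%N isT; rewrite /cf_digit /= => td.
(* The inverse of 0 is 0 by convention, so [x = 0] would have digit 0, against [0 < d]. *)
have {x0}x0 : 0 < x.
  rewrite lt_neqAle x0 andbT; apply/eqP => xE; move: td; rewrite -xE invr0 truncn0 => E.
  by rewrite -E in d0.
have d1 := @ler1n_digit R _ d0.
have := @truncn_itv _ x^-1; rewrite invr_ge0 (ltW x0) td -natr1 => /(_ isT) /andP[h1 h2].
pose y := x^-1 - d%:R; have y01 : 0 <= y < 1 by rewrite /y; apply/andP; split; lra.
have xE : x = (d%:R + y)^-1 by rewrite /y addrCA subrr addr0 invrK.
have : cylinder s y by apply/(cylinder_cons s d0 y01); rewrite -xE.
move=> /(IH s0); rewrite /= !in_itv /= => /andP[y1 y2].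
have [b1 b2 b3] := @hull_bounds R s s0; have /andP[y0 _] := y01.
by rewrite xE /next !lef_pV2 ?posrE; [apply/andP; split| | | |]; lra.
Qed.

Lemma itv_subset_cylinder s : poss s ->
  `](hull s).1, (hull s).2[ `<=` @cylinder R s.
Proof.
elim: s => [_ x|d s IH /andP[d0 s0] x] /=; rewrite in_itv /= => /andP[x1 x2].
  by split; [rewrite ltW|].
have d1 := @ler1n_digit R _ d0; have [b1 b2 b3] := @hull_bounds R s s0.
have n1 : 0 < next d (hull s).2 :> R by rewrite /next invr_gt0; lra.
have x0 : 0 < x by lra.
rewrite /next in x1 x2 n1.
have h1 : d%:R + (hull s).1 < x^-1 by rewrite -[ltLHS]invrK ltf_pV2 ?posrE ?invr_gt0; lra.
have h2 : x^-1 < d%:R + (hull s).2 by rewrite -[ltRHS]invrK ltf_pV2 ?posrE ?invr_gt0; lra.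
pose y := x^-1 - d%:R; have y01 : 0 <= y < 1 by rewrite /y; apply/andP; split; lra.
have xE : x = (d%:R + y)^-1 by rewrite /y addrCA subrr addr0 invrK.
rewrite xE; apply/cylinder_cons => //.
  by rewrite -xE; apply: lt_le_trans x2 _; rewrite /next invf_le1; lra.
by apply: IH => //=; rewrite in_itv /= /y; apply/andP; split; lra.
Qed.

(** Removing the two null endpoints turns every set between the open and the closed interval into
    the open one. *)
Lemma integral_between_itv (f : R -> R) (a b : R) (A : set R) :
  `]a, b[ `<=` A -> A `<=` `[a, b] -> measurable_fun `[a, b] f ->
  (\int[mu]_(x in A) (f x)%:E = \int[mu]_(x in `[a, b]) (f x)%:E)%E.
Proof.
move=> oA Ac /measurable_EFinP mf.
have mint (B : set R) : `]a, b[ `<=` B -> B `<=` `[a, b] -> 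
    (\int[mu]_(x in B) (f x)%:E = \int[mu]_(x in `]a, b[) (f x)%:E)%E.
  move=> oB Bc.
  have E2 : (B `\ a) `\ b = `]a, b[%classic.
    apply/seteqP; split=> x /=.
      move=> [[Bx /eqP xa] /eqP xb]; have := Bc x Bx; rewrite /= !in_itv /= !lt_neqAle => /andP[-> ->].
      by rewrite xb eq_sym xa.
    move=> xab; split; [split; first exact: oB|] => xE; move: xab; rewrite xE in_itv /= ltxx //.
    by rewrite andbF.
  have mB : measurable (B `\ a).
    have [Bb|nBb] := pselect ((B `\ a) b).
      by rewrite -(setD1K Bb) E2; apply: measurableU => //; exact: measurable_set1.
    by rewrite -(not_setD1 nBb) E2.
  have Bac : B `\ a `<=` `[a, b] by move=> x [Bx _]; apply: Bc.
  rewrite -(@integral_setD1 _ (EFin \o f) a) //; last first.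
    by apply: (measurable_funS _ Bac mf).
  rewrite -(@integral_setD1 _ (EFin \o f) b) ?E2 //.
  apply: (measurable_funS _ _ mf) => //.
  by move=> x /oA /Ac.
rewrite (mint A) // (mint `[a, b]%classic) //.
by move=> x /oA /Ac.
Qed.

Lemma gauss_measure_cylinder s : poss s ->
  gauss_measure (@cylinder R s) = (gauss_cyl s)%:E.
Proof.
move=> s0; have [b1 b2 b3] := @hull_bounds R s s0; rewrite /gauss_measure.
have l2 := @ln2_gt0 R.
set a := (hull s).1 in b1 b2; set b := (hull s).2 in b2 b3.
have der (t : R) : 0 <= t -> is_derive t 1 (fun u : R => (ln (1 + u * 1) / ln 2 : R)) ((1 + t)^-1 / ln 2).
  move=> t0; have tb : 0 < 1 + t * 1 by lra.
  refine (is_derive_eq (is_deriveM (is_derive_ln_affine tb) (is_derive_cst _ _ _)) _).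
  by rewrite scaler0 add0r /GRing.scale /= !mulr1 mul1r mulrC.
have cont : {within `[a, b], continuous (fun y : R => (1 + y)^-1 / ln 2)}.
  apply: derivable_within_continuous => x; rewrite in_itv /= => /andP[xa _].
  apply: derivableM => //; apply: derivableV; first by apply/lt0r_neq0; lra.
  exact: derivableD.
rewrite (@integral_between_itv _ a b).
- rewrite (@continuous_FTC2 _ _ (fun u => ln (1 + u * 1) / ln 2)) //.
  + by rewrite -EFinB /gauss_cyl !mulr1 mulrBl.
  + have c0 (t : R) : 0 <= t -> {for t, continuous (fun u : R => (ln (1 + u * 1) / ln 2 : R))}.
      by move=> t0; apply/differentiable_continuous/derivable1_diffP; apply: (@ex_derive _ _ _ _ _ _ _ (der t t0)).
    split.
    * by move=> x; rewrite in_itv /= => /andP[xa _]; apply: (@ex_derive _ _ _ _ _ _ _ (der x _)); lra.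
    * by apply: cvg_at_right_filter; apply: c0.
    * by apply: cvg_at_left_filter; apply: c0; lra.
  + move=> x; rewrite in_itv /= => /andP[xa _]; have x0 : 0 <= x by lra.
    by rewrite derive1E; have := der x x0 => d'; rewrite derive_val.
- exact: itv_subset_cylinder.
- exact: cylinder_subset.
- apply: subspace_continuous_measurable_fun => //.
Qed.

End GaussMeasure.

(** * Real numbers with prescribed digits *)

Section Expansion.
Context {R : realType}.
Variable a : nat -> nat.
Hypothesis a_pos : forall i, (0 < a i)%N.

Let tl m n := [seq a i | i <- iota m n].

Let poss_tl m n : poss (tl m n).
Proof. by apply/allP => d /mapP[i _ ->]. Qed.

Lemma hull_cat (v w : seq nat) : poss v -> poss w ->
  (hull (R := R) v).1 <= (hull (v ++ w)).1 /\ (hull (v ++ w)).2 <= (hull (R := R) v).2.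
Proof.
elim: v => [_ w0|d v IH /andP[d0 v0] w0] /=; first by have [] := @hull_bounds R w w0.
have [h1 h2] := IH v0 w0; have d1 := @ler1n_digit R _ d0.
have [x1 x2 x3] := @hull_bounds R v v0.
have vw0 : poss (v ++ w) by rewrite /poss all_cat; apply/andP.
have [y1 y2 y3] := @hull_bounds R (v ++ w) vw0.
by split; rewrite /next lef_pV2 ?posrE; lra.
Qed.

Let lo m n : R := (hull (tl m n)).1.
Let hi m n : R := (hull (tl m n)).2.

Let lo_hi m n k : lo m n <= hi m k.
Proof.
have mono i j : (i <= j)%N -> lo m i <= lo m j /\ hi m j <= hi m i.
  move=> ij; rewrite /lo /hi; have -> : tl m j = tl m i ++ tl (m + i) (j - i).
    by rewrite /tl -map_cat -iotaD subnKC.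
  exact: hull_cat.
have lh i : lo m i < hi m i by have [] := @hull_bounds R _ (poss_tl m i).
have [nk|/ltnW kn] := leqP n k.
  by have [h1 h2] := mono _ _ nk; have := lh k; lra.
by have [h1 h2] := mono _ _ kn; have := lh n; lra.
Qed.

(** The number with digits [a m, a (m+1), ...], as a common point of the nested hulls. All shifts
    are kept because the Gauss map sends the value at [m] to the one at [m + 1]. *)
Definition cf_value m : R := sup (range (lo m)).

Let value_bounds m n : lo m n <= cf_value m <= hi m n.
Proof.
apply/andP; split.
  apply: ub_le_sup; last by exists n.
  by exists (hi m 0) => _ [k _ <-]; apply: lo_hi.
by apply: ge_sup; [exists (lo m 0); exists 0%N | move=> _ [k _ <-]; apply: lo_hi].
Qed.

Let width m n : hi m n - lo m n <= ((2 ^ n./2)%N%:R)^-1.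
Proof.
have -> : hi m n - lo m n = wt digp 0 (tl m n).
  by rewrite wt_digp_hull // /mob !mul0r !addr0 !mul1r !divr1.
have := @wt_digp_qst R 0 1 (tl m n) isT (poss_tl m n); rewrite mul0r addr0 !mul1r => ->.
have -> : foldl qstep (0, 1)%N (tl m n) = qst (tl m n) by [].
have := den_pow (poss_tl m n); rewrite -qst_den size_map size_iota.
case: (qst _) => q' q /= hq.
have p0 : (0 < 2 ^ n./2)%N by rewrite expn_gt0.
have q0 : 1 <= q%:R :> R by rewrite ler1n (leq_trans p0).
have q'0 : 0 <= q'%:R :> R by [].
have hq' : (2 ^ n./2)%N%:R <= q%:R :> R by rewrite ler_nat.
have p0' : 0 < (2 ^ n./2)%N%:R :> R by rewrite ltr0n.
by rewrite lef_pV2 ?posrE; nra.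
Qed.

(** Both sides lie in the hull of the [n + 1] digits from [m] on, whose width tends to 0. *)
Let value_next m : cf_value m = next (a m) (cf_value m.+1).
Proof.
have B n : `|cf_value m - next (a m) (cf_value m.+1)| <= ((2 ^ n.+1./2)%N%:R)^-1.
  apply: le_trans (width m n.+1).
  have /andP[h1 h2] := value_bounds m n.+1; have /andP[h3 h4] := value_bounds m.+1 n.
  have [b1 b2 b3] := @hull_bounds R _ (poss_tl m.+1 n); have d1 := @ler1n_digit R _ (a_pos m).
  have k1 : lo m n.+1 <= next (a m) (cf_value m.+1).
    by rewrite /lo /= /next lef_pV2 ?posrE -/(tl _ _) -/(hi m.+1 n); move: h3; rewrite /lo; lra.
  have k2 : next (a m) (cf_value m.+1) <= hi m n.+1.
    by rewrite /hi /= /next lef_pV2 ?posrE -/(tl _ _) -/(lo m.+1 n); move: h3; rewrite /lo; lra.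
  by rewrite ler_norml; apply/andP; split; lra.
apply/eqP; rewrite -subr_eq0 -normr_eq0; apply/negPn/negP => ne.
have e0 : 0 < `|cf_value m - next (a m) (cf_value m.+1)| by rewrite lt_neqAle eq_sym ne normr_ge0.
set e := `| _ | in B e0.
(* With [n = 2N] the width is at most [2^(-N)], which is below [e] since [2^N >= N + 1 > 1/e]. *)
pose N := Num.truncn e^-1; have := B (N.*2); rewrite leNgt => /negP; apply.
rewrite -[ltRHS]invrK ltf_pV2 ?posrE ?invr_gt0 ?ltr0n ?expn_gt0 //.
apply: lt_le_trans (truncnS_gt _) _; rewrite ler_nat -/N.
by rewrite -[N.*2.+1]/(true + N.*2)%N half_bit_double ltn_expl.
Qed.

Lemma cf_digits_exist : exists x : R, 0 <= x < 1 /\ forall i, cf_digit x i.+1 = a i.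
Proof.
have v0 m : 0 < cf_value m.
  rewrite value_next invr_gt0; have d1 := @ler1n_digit R _ (a_pos m).
  by have := value_bounds m.+1 0; rewrite /lo /= => /andP[]; lra.
have v1 m : cf_value m < 1.
  rewrite value_next /next; have d1 := @ler1n_digit R _ (a_pos m); have := v0 m.+1.
  by move=> ?; rewrite invf_lt1; lra.
have v01 m : 0 <= cf_value m < 1 by rewrite v1 ltW.
exists (cf_value 0); split=> // i.
have it : iter i gauss_map (cf_value 0) = cf_value i.
  elim: i => // i IH; rewrite iterS IH value_next.
  by have [] := @gauss_map_digit R _ _ (a_pos i) (v01 i.+1).
rewrite /cf_digit /= it value_next.
by have [] := @gauss_map_digit R _ _ (a_pos i) (v01 i.+1).
Qed.

End Expansion.

(** * Concatenated expansions *)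

(** An additional occurrence straddles the junction, so it starts in [w1] within [size s] letters of
    its end. *)
Lemma cnt_cat s w1 w2 :
  (cnt s w1 + cnt s w2 <= cnt s (w1 ++ w2) <= cnt s w1 + cnt s w2 + minn (size w1) (size s))%N.
Proof.
elim: w1 => [|d w1 IH]; first by rewrite min0n addn0 leqnn.
rewrite cat_cons !cnt_cons -cat_cons.
have [sz|sz] := leqP (size s) (size (d :: w1)).
  rewrite prefix_cat_size //; move: IH sz; case: (prefix s (d :: w1)) => /=; lia.
have -> : prefix s (d :: w1) = false.
  by apply/negP => /size_prefix; rewrite leqNgt sz.
by move: IH sz => /=; case: (prefix s ((d :: w1) ++ w2)) => /=; lia.
Qed.

Lemma cnt_count s w : cnt s w = count (fun i => prefix s (drop i w)) (iota 0 (size w)).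
Proof.
elim: w => // d w IH; rewrite cnt_cons IH /= -[1%N]/(1 + 0)%N iotaDl count_map.
by congr addn; apply: eq_count => i.
Qed.

Section Concatenation.
Variable f : nat -> nat.
Hypothesis f_pos : forall n, (0 < n)%N -> (0 < f n)%N.

Lemma xf_prefixS n : xf_prefix f n.+1 = xf_prefix f n ++ cf_rat (rseq (f n.+1)).
Proof. by rewrite /xf_prefix -{1}(addn1 n) iotaD map_cat flatten_cat /= cats0. Qed.

Lemma SL_S n : SL f n.+1 = (SL f n + Lcf (rseq (f n.+1)))%N.
Proof. by rewrite /SL big_nat_recr. Qed.

Lemma SL0 : SL f 0 = 0%N.
Proof. by rewrite /SL big_geq. Qed.

Lemma ML_S n : ML f n.+1 = maxn (ML f n) (Lcf (rseq (f n.+1))).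
Proof. by rewrite /ML big_nat_recr. Qed.

Lemma size_xf_prefix n : size (xf_prefix f n) = SL f n.
Proof.
elim: n => [|n IH]; first by rewrite SL0.
by rewrite xf_prefixS size_cat IH SL_S.
Qed.

Lemma xf_prefix_cat n m : (n <= m)%N -> exists r, xf_prefix f m = xf_prefix f n ++ r.
Proof.
move=> /subnKC <-; elim: (m - n)%N => [|k [r IH]]; first by exists [::]; rewrite addn0 cats0.
by rewrite addnS xf_prefixS IH -catA; eexists.
Qed.

Lemma SL_ge n : (n <= SL f n)%N.
Proof.
by elim: n => // n IH; rewrite SL_S; have := Lcf_gt0 (f_pos (ltn0Sn n)); lia.
Qed.

Lemma nth_xf_prefix n i : (i < SL f n)%N -> nth 0%N (xf_prefix f n) i = xf_digit f i.+1.
Proof.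
move=> iS; rewrite /xf_digit /=; have ii := SL_ge i.+1.
have [ni|/ltnW ni] := leqP n i.+1; have [r ->] := xf_prefix_cat ni.
  by rewrite nth_cat size_xf_prefix iS.
by rewrite nth_cat size_xf_prefix ii.
Qed.

Lemma xf_digit_gt0 i : (0 < xf_digit f i.+1)%N.
Proof.
have ii := SL_ge i.+1; rewrite -(nth_xf_prefix ii).
have pos n : poss (xf_prefix f n).
  elim: n => // n IH; rewrite xf_prefixS /poss all_cat; apply/andP; split => //.
  exact/poss_cf_rat/f_pos.
by apply: (allP (pos i.+1)); apply: mem_nth; rewrite size_xf_prefix.
Qed.

Definition xf_word N := [seq xf_digit f i.+1 | i <- iota 0 N].

Lemma xf_word_SL n : xf_word (SL f n) = xf_prefix f n.
Proof.
apply: (@eq_from_nth _ 0%N); first by rewrite size_map size_iota size_xf_prefix.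
move=> i; rewrite size_map size_iota => iS.
by rewrite (nth_map 0%N) ?size_iota // nth_iota // nth_xf_prefix.
Qed.

Lemma xf_wordD N k : xf_word (N + k) = xf_word N ++ [seq xf_digit f i.+1 | i <- iota N k].
Proof. by rewrite /xf_word iotaD map_cat. Qed.

(** [occ_count] also accepts occurrences that start by [N] and end later; reading [size s] more
    digits captures these, and each such digit adds at most one occurrence to [cnt]. *)
Lemma occ_count_cnt (R : realType) s (x : R) N : (0 < size s)%N ->
  (forall i, (0 < i)%N -> cf_digit x i = xf_digit f i) ->
  (cnt s (xf_word N) <= occ_count s N x <= cnt s (xf_word N) + size s)%N.
Proof.
move=> s0 xd.
pose P i := all (fun j => xf_digit f (i.+1 + j) == nth 0%N s j) (iota 0 (size s)).
have occE : occ_count s N x = count P (iota 0 N).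
  rewrite /occ_count -[1%N]/(1 + 0)%N iotaDl count_map; apply: eq_count => i /=.
  by apply: eq_in_all => j _; rewrite xd // add1n.
have pE M i : prefix s (drop i (xf_word M)) = (i + size s <= M)%N && P i.
  apply/idP/andP => [p|[iM /allP H]].
    have iM : (i + size s <= M)%N.
      have h := size_prefix p; rewrite size_drop size_map size_iota in h.
      by rewrite -leq_subRL // ltnW // -subn_gt0 (leq_trans s0 h).
    split=> //; apply/allP => j; rewrite mem_iota add0n => /andP[_ js]; apply/eqP.
    move: p => /prefixP[r E]; have := congr1 (fun w => nth 0%N w j) E.
    rewrite nth_drop nth_cat js => <-.
    have ijM : (i + j < M)%N by apply: leq_trans iM; rewrite ltn_add2l.
    by rewrite (nth_map 0%N) ?size_iota ?nth_iota ?addSn.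
  have sM : (size s <= size (drop i (xf_word M)))%N.
    by rewrite size_drop size_map size_iota leq_subRL // (leq_trans (leq_addr _ _) iM).
  rewrite prefixE; apply/eqP; apply: (@eq_from_nth _ 0%N).
    exact: size_takel sM.
  move=> j; rewrite (size_takel sM) => js.
  have ijM : (i + j < M)%N by apply: leq_trans iM; rewrite ltn_add2l.
  rewrite nth_take // nth_drop (nth_map 0%N) ?size_iota ?nth_iota //.
  by have := H j; rewrite mem_iota js => /(_ isT) /eqP <-; rewrite add0n addSn.
rewrite occE; apply/andP; split.
  rewrite cnt_count size_map size_iota; apply: sub_count => i /=.
  by rewrite pE => /andP[].
have /andP[_] := cnt_cat_r (xf_word N) [seq xf_digit f i.+1 | i <- iota N (size s)] s0.
rewrite -xf_wordD size_map size_iota; apply: leq_trans.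
rewrite cnt_count size_map size_iota iotaD count_cat.
apply: leq_trans (leq_addr _ _); rewrite leq_eqVlt; apply/orP; left; apply/eqP.
apply: eq_in_count => i; rewrite mem_iota => /andP[_ iN].
by rewrite pE leq_add2r (ltnW iN).
Qed.

Section Deviation.
Context {R : realType}.
Variable s : seq nat.
Hypothesis s_gt0 : (0 < size s)%N.
Hypothesis s_pos : poss s.

Let bad (eps : R) i := eps * (Lcf (rseq i))%:R < `|dev s (cf_rat (rseq i))|.

(** Three sources of error: [size s] at each junction, [eps] times the length on good blocks, and
    the full length, at most [ML f n], on each bad block. *)
Lemma dev_xf_prefix (eps : R) n : 0 <= eps ->
  `|dev s (xf_prefix f n) : R| <= (n * size s)%N%:R + eps * (SL f n)%:R +
     (count_upto (fun i => bad eps (f i)) n * ML f n)%N%:R.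
Proof.
move=> e0; elim: n => [|n IH].
  by rewrite /dev /= mulr0 subrr normr0 !addr_ge0 ?mulr_ge0.
set w := cf_rat (rseq (f n.+1)).
have cE : count_upto (fun i => bad eps (f i)) n.+1 =
    (count_upto (fun i => bad eps (f i)) n + bad eps (f n.+1))%N.
  by rewrite /count_upto -{1}(addn1 n) iotaD count_cat /= addn0.
have D1 : `|dev s (xf_prefix f n.+1) - (dev s (xf_prefix f n) + dev s w)| <= (size s)%:R :> R.
  rewrite xf_prefixS -/w /dev size_cat.
  have := cnt_cat s (xf_prefix f n) w => /andP[c1 c2].
  set c := (cnt _ (_ ++ _))%:R.
  have C1 : (cnt s (xf_prefix f n))%:R + (cnt s w)%:R <= c :> R by rewrite -natrD ler_nat.
  have C2 : c <= (cnt s (xf_prefix f n))%:R + (cnt s w)%:R + (size s)%:R :> R.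
    by rewrite -!natrD ler_nat (leq_trans c2) // leq_add2l geq_minr.
  by rewrite natrD ler_norml; apply/andP; split; lra.
have D2 : `|dev s w : R| <= eps * (Lcf (rseq (f n.+1)))%:R + (bad eps (f n.+1) * ML f n.+1)%N%:R.
  rewrite /bad; case: ltP => [_|//]; last by rewrite mul0n addr0.
  rewrite mul1n; apply: le_trans (dev_le_size s_pos w) _.
  rewrite -[leLHS]add0r lerD ?mulr_ge0 // ler_nat ML_S; exact: leq_maxr.
have -> : (n.+1 * size s)%N%:R = (n * size s)%N%:R + (size s)%:R :> R by rewrite mulSnr natrD.
rewrite SL_S natrD mulrDr cE mulnDl natrD.
have M1 : (count_upto (fun i => bad eps (f i)) n * ML f n)%N%:R <=
   (count_upto (fun i => bad eps (f i)) n * ML f n.+1)%N%:R :> R.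
  by rewrite ler_nat leq_mul2l ML_S leq_maxl orbT.
have := lerB_dist (dev s (xf_prefix f n.+1) : R) (dev s (xf_prefix f n) + dev s w).
have := ler_normD (dev s (xf_prefix f n) : R) (dev s w).
lra.
Qed.

Lemma block_index N n0 : (SL f n0 <= N)%N ->
  exists n, [/\ (n0 <= n)%N, (SL f n <= N)%N & (N < SL f n.+1)%N].
Proof.
move=> h0; have exN : exists n, (SL f n <= N)%N by exists n0.
have leN n : (SL f n <= N)%N -> (n <= N)%N by apply: leq_trans (SL_ge n).
case: (ex_maxnP exN leN) => n hn mx; exists n; split=> //; first exact: mx.
by rewrite ltnNge; apply/negP => /mx; rewrite ltnn.
Qed.

(** The incomplete last block adds at most [ML f n.+1], and the occurrences overhanging [N] add one
    more [size s], whence [n.+1]. *)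
Lemma occ_deviation (eps : R) (x : R) N n : 0 <= eps ->
  (forall i, (0 < i)%N -> cf_digit x i = xf_digit f i) ->
  (SL f n <= N)%N -> (N < SL f n.+1)%N ->
  `|(occ_count s N x)%:R - gauss_cyl s * N%:R| <=
    (n.+1 * size s)%N%:R + eps * (SL f n)%:R +
     (count_upto (fun i => bad eps (f i)) n * ML f n)%N%:R + (ML f n.+1)%:R.
Proof.
move=> e0 xd nN Nn.
have /andP[c1 c2] := occ_count_cnt N s_gt0 xd.
have O1 : (cnt s (xf_word N))%:R <= (occ_count s N x)%:R :> R by rewrite ler_nat.
have O2 : (occ_count s N x)%:R <= (cnt s (xf_word N))%:R + (size s)%:R :> R.
  by rewrite -natrD ler_nat.
have D1 : `|dev s (xf_word N) - dev s (xf_prefix f n)| <= (ML f n.+1)%:R :> R.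
  rewrite -(subnKC nN) xf_wordD xf_word_SL; apply: le_trans (dev_cat_dist_r s_gt0 s_pos _ _) _.
  rewrite size_map size_iota ler_nat ML_S; apply: leq_trans (leq_maxr _ _).
  by move: Nn; rewrite SL_S; lia.
have D2 := dev_xf_prefix n e0.
have -> : (n.+1 * size s)%N%:R = (n * size s)%N%:R + (size s)%:R :> R by rewrite mulSnr natrD.
have := lerB_dist (dev s (xf_word N) : R) (dev s (xf_prefix f n)).
have E : dev s (xf_word N) = (cnt s (xf_word N))%:R - gauss_cyl s * N%:R :> R.
  by rewrite /dev size_map size_iota.
rewrite E => D3.
have : `|(cnt s (xf_word N))%:R - gauss_cyl s * N%:R| <= (n * size s)%N%:R + eps * (SL f n)%:R +
     (count_upto (fun i => bad eps (f i)) n * ML f n)%N%:R + (ML f n.+1)%:R :> R.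
  by rewrite E in D1; lra.
by rewrite !ler_norml => /andP[? ?]; apply/andP; split; lra.
Qed.

End Deviation.
End Concatenation.

(** * Normality of the concatenated number *)

Theorem theorem1p1 (R : realType) (f : nat -> nat)
  (hf : forall n : nat, (0 < n)%N -> (0 < f n)%N)
  (h_o : forall eps : R, 0 < eps ->
          exists M : nat, forall N : nat, (M <= N)%N -> (N%:R : R) <= eps * (SL f N)%:R)
  (h_O : exists C : R, exists M : nat, forall N : nat, (M <= N)%N ->
          ((N * ML f N)%N%:R : R) <= C * (SL f N)%:R)
  (h_S : forall S : pred nat,
          (exists C : R, exists M : nat, forall N : nat, (M <= N)%N ->
             ((count_upto S N)%:R : R) <= C * N%:R / ln (N%:R : R)) ->
          @density_zero R (fun n => S (f n))) :
  (exists x : R, 0 <= x < 1 /\ forall i : nat, (0 < i)%N -> cf_digit x i = xf_digit f i)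
  /\ (forall x : R, 0 <= x < 1 -> (forall i : nat, (0 < i)%N -> cf_digit x i = xf_digit f i) ->
        CF_normal x).
Proof.
split.
  have [x [x01 hx]] := @cf_digits_exist R (fun i => xf_digit f i.+1) (xf_digit_gt0 hf).
  by exists x; split=> //; case.
move=> x x01 xd s s0 sp; rewrite gauss_measure_cylinder //.
apply: cvg_EFin; first exact: nearW.
apply/cvgrPdist_le => e e0.
have [C0 [M2 HO]] := h_O.
pose l : R := (size s)%:R; pose C : R := `|C0| + 1.
have l0 : 0 <= l by [].
have C1 : 1 <= C by rewrite lerDr.
(* Half of [e] is spent on the good blocks. The other half covers junctions ([2 l del]), bad blocks
   ([C del]) and the incomplete block ([del]). *)
pose del : R := e / (2 * (2 * l + C + 1)).
have del0 : 0 < del by rewrite divr_gt0 // mulr_gt0 //; lra.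
have e20 : 0 < e / 2 by rewrite divr_gt0.
have delE : del * (2 * l + C + 1) = e / 2 by rewrite /del; field; lra.
have [M1 Ho] := h_o _ del0.
have dens := h_S _ (bad_rat_density s0 sp e20).
have [M3 _ Hd] : \forall N \near \oo, (count_upto (fun n =>
    e / 2 * (Lcf (rseq (f n)))%:R < `|dev s (cf_rat (rseq (f n)))|) N)%:R <= del * N%:R.
  move/cvgrPdist_le: dens => /(_ _ del0); apply: filterS => -[|N]; first by rewrite mulr0.
  rewrite sub0r normrN ger0_norm ?divr_ge0 // ler_pdivrMr //.
pose M4 := (Num.truncn (C + C / del)).+1.
pose n0 := (M1 + M2 + M3 + M4)%N.
(* The successor keeps [N] positive for the final division. *)
exists (SL f n0).+1 => // N /= hN.
have [n [n0n nN Nn]] := block_index hf (ltnW hN).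
have [nM1 nM2 nM3 nM4] : [/\ M1 <= n, M2 <= n, M3 <= n & M4 <= n]%N.
  by move: n0n; rewrite /n0; clear; split; lia.
have nR1 : C + C / del <= n%:R.
  by apply: ltW; apply: lt_le_trans (truncnS_gt _) _; rewrite ler_nat.
have n1 : 1 <= n%:R :> R.
  have Cd : 0 <= C / del by apply: divr_ge0; lra.
  by apply: le_trans nR1; lra.
set SLn : R := (SL f n)%:R.
have S0 : 0 <= SLn by [].
have B1 : n%:R <= del * SLn by apply: Ho.
have HC k : (M2 <= k)%N -> k%:R * (ML f k)%:R <= C * (SL f k)%:R.
  move=> /HO; rewrite natrM => h; apply: le_trans h _; rewrite ler_wpM2r //.
  by rewrite /C; have := ler_norm C0; lra.
have B2 : n%:R * (ML f n)%:R <= C * SLn by apply: HC.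
(* Here [(n+1) ML(n+1) <= C SL(n+1) <= C (SL(n) + ML(n+1))], and [n >= C + C/del] absorbs the last
   term, leaving [(C/del) ML(n+1) <= C SL(n)]. *)
have B3 : (ML f n.+1)%:R <= del * SLn.
  have := HC n.+1 (leqW nM2).
  have : (SL f n.+1)%:R <= SLn + (ML f n.+1)%:R by rewrite -natrD ler_nat SL_S leq_add2l ML_S leq_maxr.
  rewrite -natr1; set Mn : R := (ML f n.+1)%:R => h1 h2.
  have M0 : 0 <= Mn by [].
  have h3 : C / del * Mn <= C * SLn.
    have := ler_wpM2l (le_trans ler01 C1) h1; have := ler_wpM2r M0 nR1; lra.
  have C0' : 0 < C by lra.
  by move: h3; rewrite mulrAC -mulrA ler_pM2l // ler_pdivrMr // mulrC.
have /= B4 := Hd n nM3.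
(* At most [del n] of the blocks are bad, and [n ML(n) <= C SL(n)] bounds their total length. *)
have B5 : (count_upto (fun n =>
      (e / 2 * (Lcf (rseq (f n)))%:R < `|dev s (cf_rat (rseq (f n)))|)%R) n * ML f n)%N%:R
    <= del * C * SLn.
  rewrite natrM; apply: le_trans (ler_wpM2r (ler0n _ _) B4) _.
  by have := ler_wpM2l (ltW del0) B2; rewrite !mulrA.
have := occ_deviation hf s0 sp (ltW e20) xd nN Nn.
set Y := _ + (ML f n.+1)%:R => HY.
have NS : SLn <= N%:R by rewrite ler_nat.
have N0 : 0 < N%:R :> R by rewrite ltr0n (leq_trans _ hN).
have YN : Y <= e * N%:R.
  apply: le_trans (_ : e * SLn <= _); last by rewrite ler_wpM2l // ltW.
  have B6 : (n.+1 * size s)%N%:R <= 2 * l * (del * SLn).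
    rewrite natrM -natr1 -/l; have := ler_wpM2r l0 B1; have := ler_wpM2r l0 n1; lra.
  have : e * SLn = e / 2 * SLn + del * (2 * l + C + 1) * SLn by rewrite delE; lra.
  rewrite /Y -/SLn; lra.
have -> : gauss_cyl s - (occ_count s N x)%:R / N%:R =
    - (((occ_count s N x)%:R - gauss_cyl s * N%:R) / N%:R) :> R by field; lra.
rewrite normrN normrM normfV (ger0_norm (ltW N0)) ler_pdivrMr //.
exact: le_trans HY YN.
Qed.
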